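(* Let $d\ge 1$ and $k\ge 1$ be fixed integers. If $d\ge 2$, then $\psi^{\max}_{d,k}(n)=\Theta_{d,k}(n^{2dk})$ as $n\to\infty$. If $d=1$, then $\psi^{\max}_{1,k}(n)=\Theta_k\big(n^{4\lceil k/2\rceil-2}\big)$ as $n\to\infty$.
   Context: For a finite multiset $V=\{v_1,\dots,v_k\}$ of points in $\mathbb{R}^d$ (vantage points), let $D_V\colon\mathbb{R}^d\to\mathbb{R}$, $D_V(x)=\sum_{i=1}^k\|x-v_i\|$ (Euclidean norm). For a finite set $C=\{c_1,\dots,c_n\}\subseteq\mathbb{R}^d$, $V$ distinguishes $C$ if $D_V(c_1),\dots,D_V(c_n)$ are pairwise distinct; then $V$ witnesses the ordering $\Sigma^C_V=(c_{\sigma(1)},\dots,c_{\sigma(n)})$, where $\sigma$ is the permutation with $D_V(c_{\sigma(1)})<\dots<D_V(c_{\sigma(n)})$. $\Psi_k(C)$ is the set of orderings $\Sigma^C_V$ over all $k$-element multisets $V\subseteq\mathbb{R}^d$ distinguishing $C$, $\psi_k(C)=|\Psi_k(C)|$, and $\psi^{\max}_{d,k}(n)$ is the maximum of $\psi_k(C)$ over all $n$-element sets $C\subseteq\mathbb{R}^d$. $\Theta_{d,k}$ means bounded above and below by positive constants depending only on $d,k$ times the given function, for all sufficiently large $n$. *)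

(* Defs.v *)
From HB Require Import structures.
From mathcomp Require Import all_boot all_order all_algebra.
From mathcomp Require Import finmap multiset.
From mathcomp Require Import all_classical all_reals all_analysis.

Set Implicit Arguments.
Unset Strict Implicit.
Unset Printing Implicit Defensive.

Import Order.TTheory GRing.Theory Num.Theory.
Import numFieldNormedType.Exports.

Local Open Scope classical_set_scope.
Local Open Scope ring_scope.

Section VantagePoints.
Variables (R : realType) (d : nat).
Implicit Types (x : 'rV[R]_d) (V : {mset 'rV[R]_d}%mset) (C : {fset 'rV[R]_d}).

(* The library norm on row vectors is the sup norm, hence this definition. *)
Definition euclid_norm x : R := Num.sqrt (\sum_(i < d) x ord0 i ^+ 2).

(* A multiset coerces to the sequence of its elements, each listed as many
   times as its multiplicity. *)
Definition dist_sum V x : R := \sum_(v <- V) euclid_norm (x - v).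

Definition distinguishes V C : Prop := {in C &, injective (dist_sum V)}.

(* Meaningful when [V] distinguishes [C]; the sort is then strictly increasing
   in [dist_sum V], hence independent of the enumeration of [C]. *)
Definition ordering V C : seq 'rV[R]_d :=
  sort (fun x y => dist_sum V x <= dist_sum V y) C.

Definition Psi (k : nat) C : set (seq 'rV[R]_d) :=
  [set ordering V C | V in [set V : {mset 'rV[R]_d}%mset |
    size V = k /\ distinguishes V C]].

Definition psi (k : nat) C : nat := #|` fset_set (Psi k C)|.

Definition psi_values (k n : nat) : set nat :=
  [set psi k C | C in [set C : {fset 'rV[R]_d} | #|` C| = n]].

(* The greatest element of [psi_values k n], which exists as soon as [0 < d];
   see [psi_maxP]. The default value 0 is irrelevant. *)
Definition psi_max (k n : nat) : nat :=
  xget 0%N [set m | psi_values k n m /\ ubound (psi_values k n) m].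

Lemma Psi_perm k C s : Psi k C s -> s \in permutations C.
Proof. by move=> [V _ <-]; rewrite mem_permutations perm_sort. Qed.

Lemma finite_Psi k C : finite_set (Psi k C).
Proof.
apply: (@sub_finite_set _ _ [set` permutations C]) => [s|].
  exact: Psi_perm.
exact: finite_seq.
Qed.

Lemma psi_le_fact k C : (psi k C <= (#|` C|)`!)%N.
Proof.
have <- : size (permutations C) = (#|` C|)`! by rewrite size_permutations.
apply: uniq_leq_size => // s.
by rewrite in_fset_set ?inE; [exact: Psi_perm | exact: finite_Psi].
Qed.

Lemma psi_values_neq0 k n : (0 < d)%N -> psi_values k n !=set0.
Proof.
move=> d0; pose f (i : nat) : 'rV[R]_d := const_mx i%:R.
have f_inj : injective f.
  move=> i j /matrixP /(_ ord0 (Ordinal d0)); rewrite !mxE.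
  by move/eqP; rewrite eqr_nat => /eqP.
pose C := [fset x in map f (iota 0 n)]%fset.
exists (psi k C); exists C => //=.
have /perm_size -> : perm_eq C (map f (iota 0 n)).
  apply: uniq_perm; rewrite ?fset_uniq ?map_inj_uniq ?iota_uniq // => x.
  by rewrite !inE.
by rewrite size_map size_iota.
Qed.

Lemma psi_maxP k n : (0 < d)%N ->
  psi_values k n (psi_max k n) /\
  forall C, #|` C| = n -> (psi k C <= psi_max k n)%N.
Proof.
move=> d0; have [m0 m0S] := psi_values_neq0 k n d0.
have ub m : `[< psi_values k n m >] -> (m <= n`!)%N.
  by move=> /asboolP [C /= <- <-]; exact: psi_le_fact.
have ex : exists m, `[< psi_values k n m >] by exists m0; apply/asboolP.
suff [? ubm] : [set m | psi_values k n m /\ ubound (psi_values k n) m]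
    (psi_max k n).
  by split=> // C Cn; rewrite -leEnat; apply: ubm; exists C.
apply: xgetPex; case: (ex_maxnP ex ub) => m /asboolP mS mmax.
by exists m; split=> // j jS; rewrite leEnat; apply: mmax; apply/asboolP.
Qed.

End VantagePoints.

Arguments psi_max R d k n : clear implicits.

(* Main.v *)
Require Import Defs.
From mathcomp Require Import all_boot all_order all_algebra.
From mathcomp Require Import finmap multiset.
From mathcomp Require Import all_classical all_reals all_analysis.
From mathcomp Require Import ring lra zify.
From mathcomp Require ordered_qelim qe_rcf polyrcf.
Import Order.TTheory GRing.Theory Num.Theory.
Import numFieldNormedType.Exports.
Local Open Scope classical_set_scope.
Local Open Scope ring_scope.

(** Upper bound. The relation [D_V(c) < D_V(c')] is semialgebraic in the [dk]
    coordinates of [V], with parameters [(c, c')]. For a semialgebraic family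
    with [N] variables, a parameter set of size [m] cuts out only [O(m^N)]
    patterns: along the first coordinate the pattern is determined by the
    breakpoint immediately to the left, a breakpoint that belongs to one of the
    [m] parameters, so that coordinate is traded for a choice among [O(m)]
    (quantifier elimination keeps the remaining family semialgebraic), and one
    inducts on [N]. With [m = n^2] this gives [n^(2dk)]. On the line with [k]
    even, the two median vantage points enter only through their midpoint, which
    saves one coordinate.

    Lower bound. Suppose some [V] admits [r] pairs [(a_g, b_g)] with
    [D_V(a_g) = D_V(b_g)] such that the gradients in [V] of
    [D_V(a_g) - D_V(b_g)] are linearly independent. Replacing [a_g] and [b_g] by
    clusters of [p] points at scale [e] makes [D_V(a) = D_V(b)] split into [p^2]
    nearly parallel hypersurfaces per pair, hence [(p^2)^r] cells, at first
    order in [e]. For [d >= 2] one finds [r = dk] such pairs close to the points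
    of [V]; on the line nested intervals give [r = 2 ceil(k/2) - 1]. *)

Set Implicit Arguments.
Unset Strict Implicit.
Unset Printing Implicit Defensive.

(** * Semialgebraic sets *)

Section Semialgebraic.
Variable R : rcfType.
Local Notation env := (nat -> R).
Implicit Types (e : env) (f g : env -> R) (P Q : env -> Prop).

(** Polynomials and semialgebraic sets live on infinite environments and are kept as functions and
    predicates, so that substituting or renaming variables is mere composition. *)
Inductive polyfun : (env -> R) -> Prop :=
| polyfun_var i : polyfun (fun e => e i)
| polyfun_cst c : polyfun (fun=> c)
| polyfunD f g : polyfun f -> polyfun g -> polyfun (fun e => f e + g e)
| polyfunM f g : polyfun f -> polyfun g -> polyfun (fun e => f e * g e).

Inductive semialg : (env -> Prop) -> Prop :=
| semialg_gt0 f : polyfun f -> semialg (fun e => 0 < f e)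
| semialg_and P Q : semialg P -> semialg Q -> semialg (fun e => P e /\ Q e)
| semialg_not P : semialg P -> semialg (fun e => ~ P e).

Lemma eq_polyfun f g : f =1 g -> polyfun f -> polyfun g.
Proof. by move=> /funext->. Qed.

Lemma eq_semialg P Q : (forall e, P e <-> Q e) -> semialg P -> semialg Q.
Proof. by move=> PQ; suff -> : P = Q by []; apply/funext => e; apply/propext. Qed.

Lemma polyfunN f : polyfun f -> polyfun (fun e => - f e).
Proof.
move=> pf; apply: (@eq_polyfun (fun e => -1 * f e)) => [e|]; first by rewrite mulN1r.
exact: polyfunM (polyfun_cst _) pf.
Qed.

Lemma polyfunB f g : polyfun f -> polyfun g -> polyfun (fun e => f e - g e).
Proof. by move=> pf pg; apply: polyfunD => //; exact: polyfunN. Qed.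

Lemma polyfunX f n : polyfun f -> polyfun (fun e => f e ^+ n).
Proof.
move=> pf; elim: n => [|n IH]; first exact: (polyfun_cst 1).
by apply: (@eq_polyfun (fun e => f e * f e ^+ n)) => [e|];
  [rewrite exprS|exact: polyfunM].
Qed.

Lemma polyfun_sum I (r : seq I) (F : I -> env -> R) :
  (forall i, polyfun (F i)) -> polyfun (fun e => \sum_(i <- r) F i e).
Proof.
move=> pF; elim: r => [|i r IH].
  by apply: (@eq_polyfun (fun=> 0)) => [e|]; [rewrite big_nil|exact: polyfun_cst].
by apply: (@eq_polyfun (fun e => F i e + \sum_(j <- r) F j e)) => [e|];
  [rewrite big_cons|exact: polyfunD].
Qed.

Lemma polyfun_comp f (s : env -> env) :
  polyfun f -> (forall i, polyfun (fun e => s e i)) -> polyfun (fun e => f (s e)).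
Proof.
move=> pf ps; elim: pf => [i|c|? ? _ ? _ ?|? ? _ ? _ ?] //.
- exact: polyfun_cst.
- exact: polyfunD.
- exact: polyfunM.
Qed.

Lemma semialg_comp P (s : env -> env) :
  semialg P -> (forall i, polyfun (fun e => s e i)) -> semialg (fun e => P (s e)).
Proof.
move=> aP ps; elim: aP => [f pf|? ? _ ? _ ?|? _ ?].
- by apply: (@semialg_gt0 (fun e => f (s e))); exact: polyfun_comp.
- exact: semialg_and.
- exact: semialg_not.
Qed.

Lemma semialg_reindex P (s : nat -> nat) :
  semialg P -> semialg (fun e => P (fun i => e (s i))).
Proof. by move=> aP; apply: semialg_comp => // i; exact: polyfun_var. Qed.

Lemma semialg_or P Q : semialg P -> semialg Q -> semialg (fun e => P e \/ Q e).
Proof.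
move=> aP aQ; apply: (@eq_semialg (fun e => ~ (~ P e /\ ~ Q e))).
  move=> e; split; last tauto.
  by move=> h; apply: contrapT => h'; apply: h; tauto.
by apply/semialg_not/semialg_and; exact: semialg_not.
Qed.

Lemma semialg_imp P Q : semialg P -> semialg Q -> semialg (fun e => P e -> Q e).
Proof.
move=> aP aQ; apply: (@eq_semialg (fun e => ~ (P e /\ ~ Q e))).
  move=> e; split; last tauto.
  by move=> h p; apply: contrapT => h'; apply: h; tauto.
by apply/semialg_not/semialg_and => //; exact: semialg_not.
Qed.

Lemma semialg_lt f g : polyfun f -> polyfun g -> semialg (fun e => f e < g e).
Proof.
move=> pf pg; apply: (@eq_semialg (fun e => 0 < g e - f e)).
  by move=> e; rewrite subr_gt0.
exact/semialg_gt0/polyfunB.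
Qed.

Lemma semialg_le f g : polyfun f -> polyfun g -> semialg (fun e => f e <= g e).
Proof.
move=> pf pg; apply: (@eq_semialg (fun e => ~ (g e < f e))).
  by move=> e; rewrite leNgt; split => /negP.
exact/semialg_not/semialg_lt.
Qed.

Lemma semialg_eq f g : polyfun f -> polyfun g -> semialg (fun e => f e = g e).
Proof.
move=> pf pg; apply: (@eq_semialg (fun e => f e <= g e /\ g e <= f e)).
  move=> e; split=> [[le1 le2]|->]; last by rewrite lexx.
  by apply/eqP; rewrite eq_le le1 le2.
by apply: semialg_and; exact: semialg_le.
Qed.

Lemma semialg_cst (A : Prop) : semialg (fun=> A).
Proof.
have [a|na] := pselect A.
  apply: (@eq_semialg (fun=> (0 : R) = 0)); first by [].
  exact: semialg_eq (polyfun_cst _) (polyfun_cst _).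
apply: (@eq_semialg (fun=> (0 : R) < 0)); first by move=> _; rewrite ltxx.
exact: semialg_lt (polyfun_cst _) (polyfun_cst _).
Qed.

Definition econs (t : R) e : env := fun i => if i is j.+1 then e j else t.

Import ordered_qelim.

(** Only finitely many variables occur, so every long enough prefix of the environment evaluates the
    term; leaving [n] free above [m] lets sums and products take the larger threshold. *)
Lemma polyfun_term (f : env -> R) : polyfun f -> exists (t : GRing.term R) m,
  GRing.rterm t /\ forall e n, (m <= n)%N -> f e = GRing.eval (mkseq e n) t.
Proof.
elim=> [i|c|g h _ [t [m [rt gt]]] _ [u [m' [ru hu]]]
       |g h _ [t [m [rt gt]]] _ [u [m' [ru hu]]]].
- by exists (GRing.Var _ i), i.+1; split=> // e n lt_in /=; rewrite nth_mkseq.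
- by exists (GRing.Const c), 0%N.
- exists (GRing.Add t u), (maxn m m'); rewrite /= rt ru; split=> // e n.
  by rewrite geq_max => /andP[/gt<- /hu<-].
- exists (GRing.Mul t u), (maxn m m'); rewrite /= rt ru; split=> // e n.
  by rewrite geq_max => /andP[/gt<- /hu<-].
Qed.

Lemma semialg_formula P : semialg P -> exists (F : ord.formula R) m,
  ord.rformula F /\
  forall e n, (m <= n)%N -> P e <-> ord.holds (mkseq e n) F.
Proof.
elim=> [f /polyfun_term[t [m [rt ft]]]
  |? ? _ [F [m [rF hF]]] _ [G [m' [rG hG]]]|? _ [F [m [rF hF]]]].
- exists (ord.Lt (GRing.Const 0) t), m; rewrite /= rt; split=> // e n le_mn.
  by rewrite (ft e n le_mn).
- exists (ord.And F G), (maxn m m'); rewrite /= rF rG; split=> // e n.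
  by rewrite geq_max => /andP[/(hF e) + /(hG e)] /=; tauto.
- by exists (ord.Not F), m; rewrite /= rF; split=> // e n /(hF e) /=; tauto.
Qed.

Lemma polyfun_eval (t : GRing.term R) (s : env -> seq R) :
  GRing.rterm t -> (forall i, polyfun (fun e => (s e)`_i)) ->
  polyfun (fun e => GRing.eval (s e) t).
Proof.
move=> + ps; elim: t => //=.
- by move=> r _; exact: polyfun_cst.
- by move=> r _; exact: polyfun_cst.
- by move=> t IHt u IHu /andP[/IHt ? /IHu ?]; exact: polyfunD.
- by move=> t IHt /IHt ?; exact: polyfunN.
- move=> t IHt n /IHt ?.
  apply: (@eq_polyfun (fun e => GRing.eval (s e) t * n%:R)).
    by move=> e; rewrite mulr_natr.
  by apply: polyfunM => //; exact: polyfun_cst.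
- by move=> t IHt u IHu /andP[/IHt ? /IHu ?]; exact: polyfunM.
- by move=> t IHt n /IHt ?; exact: polyfunX.
Qed.

Lemma semialg_qf (F : ord.formula R) (s : env -> seq R) :
  ord.qf_form F -> ord.rformula F -> (forall i, polyfun (fun e => (s e)`_i)) ->
  semialg (fun e => ord.holds (s e) F).
Proof.
move=> + + ps; elim: F => //=.
- by move=> b _ _; exact: semialg_cst.
- by move=> t u _ /andP[? ?]; apply: semialg_eq; exact: polyfun_eval.
- by move=> t u _ /andP[? ?]; apply: semialg_lt; exact: polyfun_eval.
- by move=> t u _ /andP[? ?]; apply: semialg_le; exact: polyfun_eval.
- by move=> F IHF G IHG /andP[? ?] /andP[? ?]; apply: semialg_and; auto.
- by move=> F IHF G IHG /andP[? ?] /andP[? ?]; apply: semialg_or; auto.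
- by move=> F IHF G IHG /andP[? ?] /andP[? ?]; apply: semialg_imp; auto.
- by move=> F IHF ? ?; apply: semialg_not; auto.
Qed.

(* Tarski-Seidenberg, from quantifier elimination. *)
Lemma semialg_exists P : semialg P -> semialg (fun e => exists t, P (econs t e)).
Proof.
move=> /semialg_formula[F [m [rF hF]]].
pose G : ord.formula R := ord.Exists 0%N F.
have rG : ord.rformula G by [].
pose q := ord.quantifier_elim (fun i bc => qe_rcf.qfr_to_formula (@qe_rcf.wproj R i bc)) G.
have /andP[qfq rq] := ord.quantifier_elim_wf (@qe_rcf.wf_QE_wproj R) rG.
(* Variable 0 is the one bound in [G]; the leading 0 reserves its slot. *)
pose s e := 0 :: mkseq e m.
apply: (@eq_semialg (fun e => ord.holds (s e) q)); last first.
  apply: semialg_qf => // -[|i]; first exact: polyfun_cst.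
  have [lt_im|le_mi] := ltnP i m.
    apply: (@eq_polyfun (fun e => e i)); last exact: polyfun_var.
    by move=> e /=; rewrite nth_mkseq.
  apply: (@eq_polyfun (fun=> 0)); last exact: polyfun_cst.
  by move=> e /=; rewrite nth_default // size_mkseq.
move=> e.
have qP := ord.quantifier_elim_rformP (@qe_rcf.wf_QE_wproj R)
  (@qe_rcf.valid_QE_wproj R) (s e) rG.
apply: (iff_trans (rwP (ord.qf_evalP _ qfq))).
apply: (iff_trans (iff_sym (rwP qP))).
have consE t : mkseq (econs t e) m.+1 = t :: mkseq e m.
  by rewrite /mkseq /= (iotaDl 1 0) -map_comp.
by split=> -[t Ft]; exists t; have := hF (econs t e) _ (leqnSn m);
  rewrite consE; tauto.
Qed.

Lemma semialg_forall P : semialg P -> semialg (fun e => forall t, P (econs t e)).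
Proof.
move=> aP; apply: (@eq_semialg (fun e => ~ exists t, ~ P (econs t e))).
  move=> e; split=> [h t|h [t]]; last exact.
  by apply: contrapT => nP; apply: h; exists t.
exact: semialg_not (semialg_exists (semialg_not aP)).
Qed.

End Semialgebraic.

Lemma seq_max (R : realDomainType) (r : seq R) :
  r != [::] -> exists2 m, m \in r & {in r, forall x, x <= m}.
Proof.
elim: r => // x [|y r] IH _.
  by exists x; rewrite ?mem_head // => z; rewrite inE => /eqP->.
have [//|m mr mmax] := IH; have [le_xm|lt_mx] := leP x m.
  by exists m; [rewrite inE mr orbT|move=> z; rewrite inE => /orP[/eqP->|/mmax]].
exists x; first by rewrite mem_head.
move=> z; rewrite inE => /orP[/eqP->//|/mmax le_zm].
exact: le_trans le_zm (ltW lt_mx).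
Qed.

(** * Breakpoints of a semialgebraic set along the first coordinate *)

Section Breakpoints.
Variable R : rcfType.
Local Notation env := (nat -> R).
Implicit Types (e : env) (f g : env -> R) (P Q E : env -> Prop).

Definition etail e : env := fun i => e i.+1.

(** Here the bound variable is a separate argument, the shape in which later goals present it. *)
Lemma semialg_ex (P : R -> env -> Prop) :
  semialg (fun e => P (e 0%N) (etail e)) -> semialg (fun e => exists t, P t e).
Proof. exact: semialg_exists. Qed.

Lemma semialg_all (P : R -> env -> Prop) :
  semialg (fun e => P (e 0%N) (etail e)) -> semialg (fun e => forall t, P t e).
Proof. exact: semialg_forall. Qed.

Lemma semialg_econs P f (s : nat -> nat) : semialg P -> polyfun f ->
  semialg (fun e => P (econs (f e) (fun i => e (s i)))).
Proof.
move=> aP pf; apply: (semialg_comp (s := fun e => econs (f e) (fun i => e (s i)))).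
  exact: aP.
by case=> [|i] //=; exact: polyfun_var.
Qed.

(** The degree bound [D] does not depend on [e]; this uniformity later bounds the number of
    breakpoints on every line by one constant. *)
Lemma polyfun_poly f : polyfun f -> exists D, forall e, exists p : {poly R},
  (size p <= D)%N /\ forall t, f (econs t e) = p.[t].
Proof.
elim=> [[|i]|c|g h _ [D IHg] _ [D' IHh]|g h _ [D IHg] _ [D' IHh]].
- by exists 2%N => e; exists 'X; rewrite size_polyX; split=> // t; rewrite hornerX.
- exists 1%N => e; exists (e i)%:P; split=> [|t]; last by rewrite hornerC.
  exact: size_polyC_leq1.
- exists 1%N => e; exists c%:P; split=> [|t]; last by rewrite hornerC.
  exact: size_polyC_leq1.
- exists (maxn D D') => e; have [p [sp hp]] := IHg e; have [q [sq hq]] := IHh e.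
  exists (p + q); split=> [|t]; last by rewrite hornerD hp hq.
  by rewrite (leq_trans (size_polyD _ _)) // geq_max !leq_max sp sq orbT.
- exists (D + D')%N => e; have [p [sp hp]] := IHg e; have [q [sq hq]] := IHh e.
  exists (p * q); split=> [|t]; last by rewrite hornerM hp hq.
  by rewrite (leq_trans (size_polyMleq _ _)) // (leq_trans (leq_pred _)) // leq_add.
Qed.

(* [E] collects the zeros of the finitely many polynomials defining [P] that do
   not vanish identically along the first coordinate. *)
Lemma semialg_breakpoints P : semialg P -> exists E K,
  [/\ semialg E,
      forall e, exists2 r : seq R, (size r <= K)%N &
        forall t, E (econs t e) -> t \in r &
      forall e t t', t <= t' ->
        (forall s, t <= s <= t' -> ~ E (econs s e)) ->
        (P (econs t e) <-> P (econs t' e))].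
Proof.
elim=> [f pf|P1 P2 _ [E1 [K1 [aE1 fE1 cE1]]] _ [E2 [K2 [aE2 fE2 cE2]]]|
        P1 _ [E [K [aE fE cE]]]].
- exists (fun e => f e = 0 /\ exists t, f (econs t (etail e)) <> 0).
  have [D fD] := polyfun_poly pf; exists D; split.
  + apply: semialg_and; first exact: semialg_eq pf (polyfun_cst _).
    apply: semialg_ex; apply/semialg_not.
    apply: semialg_eq (polyfun_cst _).
    apply: (polyfun_comp (s := fun e => econs (e 0%N) (fun i => e i.+2))) => //.
    by case=> [|i]; exact: polyfun_var.
  + move=> e; have [p [sp fp]] := fD e; have [p0|pn0] := eqVneq p 0.
      exists [::] => // t [_ [s]]; have -> : etail (econs t e) = e by [].
      by rewrite fp p0 horner0.
    exists (polyrcf.rootsR p).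
      apply: leq_trans sp; apply/ltnW/max_poly_roots => //.
        by apply/allP => x; rewrite -(polyrcf.roots_on_rootsR pn0) => /andP[].
      exact: polyrcf.uniq_roots.
    move=> t [+ _]; rewrite fp => pt0.
    by rewrite -(polyrcf.roots_on_rootsR pn0) /= /root pt0 eqxx.
  + move=> e t t' le_tt' nE; have [p [_ fp]] := fD e.
    (* A line along which [f] vanishes identically carries no breakpoint of [f], and the condition
       [0 < f] fails on all of it. *)
    have [[s fs]|h] := pselect (exists s, f (econs s e) <> 0); last first.
      have f0 s : f (econs s e) = 0 by apply: contrapT => ?; apply: h; exists s.
      by rewrite !f0.
    (* A polynomial without a root between [t] and [t'] keeps its sign there. *)
    have hsg : Num.sg p.[t] = Num.sg p.[t'].
      apply: (@polyrcf.polyrN0_itv _ `[t, t'] p); rewrite ?in_itv /= ?lexx ?le_tt' //.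
      move=> x; rewrite in_itv /= => tx; apply/negP => /eqP px0.
      by apply: (nE x tx); split; [rewrite fp|exists s].
    by rewrite !fp -sgr_gt0 hsg sgr_gt0.
- exists (fun e => E1 e \/ E2 e), (K1 + K2)%N; split.
  + exact: semialg_or.
  + move=> e; have [r1 s1 m1] := fE1 e; have [r2 s2 m2] := fE2 e.
    exists (r1 ++ r2); first by rewrite size_cat leq_add.
    by move=> t [/m1|/m2] tr; rewrite mem_cat tr ?orbT.
  + move=> e t t' le_tt' nE.
    have := cE1 e t t' le_tt' (fun s ts Es => nE s ts (or_introl Es)).
    have := cE2 e t t' le_tt' (fun s ts Es => nE s ts (or_intror Es)).
    by move=> {cE1 cE2 nE fE1 fE2}; tauto.
- exists E, K; split=> // e t t' le_tt' nE.
  by have := cE e t t' le_tt' nE; move=> {cE nE fE}; tauto.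
Qed.

(** The head coordinate is the point number [j], counted from 0 in increasing order, among the
    points of [E] on its line. Descending through predecessors keeps the condition first-order,
    hence semialgebraic. *)
Fixpoint rank_pt E (j : nat) : env -> Prop :=
  if j is i.+1 then
    fun e => E e /\ exists s, s < e 0%N /\ rank_pt E i (econs s (etail e)) /\
      forall u, s < u -> u < e 0%N -> ~ E (econs u (etail e))
  else fun e => E e /\ forall s, s < e 0%N -> ~ E (econs s (etail e)).

Lemma semialg_rank_pt E j : semialg E -> semialg (rank_pt E j).
Proof.
have pv := @polyfun_var R; move=> aE; elim: j => [|j IH].
  apply: semialg_and => //; apply: semialg_all; apply: semialg_imp.
    exact: (semialg_lt (pv 0%N) (pv 1%N)).
  by apply: semialg_not; apply: (semialg_econs (fun i => i.+2)).
apply: semialg_and => //; apply: semialg_ex; apply: semialg_and.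
  exact: (semialg_lt (pv 0%N) (pv 1%N)).
apply: semialg_and; first by apply: (semialg_econs (fun i => i.+2)).
apply: semialg_all; apply: semialg_imp; first exact: (semialg_lt (pv 1%N) (pv 0%N)).
apply: semialg_imp; first exact: (semialg_lt (pv 0%N) (pv 2%N)).
by apply: semialg_not; apply: (semialg_econs (fun i => i.+3)).
Qed.

Lemma rank_pt_inj E j e t t' :
  rank_pt E j (econs t e) -> rank_pt E j (econs t' e) -> t = t'.
Proof.
elim: j t t' => [|j IH] t t' /=.
  move=> [Et ht] [Et' ht']; have [lt_tt'|lt_t't|//] := ltgtP t t'.
    by case: (ht' _ lt_tt').
  by case: (ht _ lt_t't).
move=> [Et [s [lt_st [rs hs]]]] [Et' [s' [lt_s't' [rs' hs']]]].
have ss' := IH _ _ rs rs'; subst s'.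
have [lt_tt'|lt_t't|//] := ltgtP t t'.
  by case: (hs' _ lt_st lt_tt').
by case: (hs _ lt_s't' lt_t't).
Qed.

(** Induction on the number of points of [E] below [t]; the largest of them is the predecessor that
    [rank_pt] asks for. *)
Lemma rank_pt_exists E e (r : seq R) t :
  (forall t, E (econs t e) -> t \in r) -> E (econs t e) ->
  exists2 j, (j <= size r)%N & rank_pt E j (econs t e).
Proof.
move=> Er Et; pose below (r' : seq R) t := [seq s <- r' | (s < t) && `[< E (econs s e) >]].
suff: exists2 j, (j <= size (below r t))%N & rank_pt E j (econs t e).
  by move=> [j jr rj]; exists j => //; rewrite (leq_trans jr) // size_filter count_size.
move: {-1}(size _) (leqnn (size (below r t))) => n.
elim: n t Et => [|n IH] t Et bt.
  exists 0%N => //; split=> // s /= lt_st Es.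
  move: bt; rewrite leqn0 => /nilP /eqP; rewrite -[_ == _]negbK -has_filter => /negP; apply.
  by apply/hasP; exists s; [exact: Er|rewrite lt_st; apply/asboolP].
have [b0|bn0] := eqVneq (below r t) [::].
  have [|j j0 rj] := IH t Et; first by rewrite b0.
  by exists j => //; exact: leqW.
have [s sb smax] := seq_max bn0.
move: (sb); rewrite mem_filter => /andP[/andP[lt_st /asboolP Es] sr].
have sub : {subset s :: below r s <= below r t}.
  move=> u; rewrite inE => /predU1P[->//|]; rewrite !mem_filter.
  by move=> /andP[/andP[lt_us ->] ->]; rewrite (lt_trans lt_us lt_st).
(* The point [s] counts as below [t] but not as below itself. *)
have : (size (below r s) < size (below r t))%N.
  rewrite !size_filter -![count _ r]size_filter.
  rewrite -/(below r s) -/(below r t).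
  have -> : below r s = [seq u <- below r t | u < s].
    rewrite /below -filter_predI; apply: eq_filter => u /=.
    by case: ltP => //= lt_us; rewrite (lt_trans lt_us lt_st).
  rewrite size_filter -(count_predC (fun u => u < s) (below r t)) -addn1 leq_add2l -has_count.
  by apply/hasP; exists s => //=; rewrite ltxx.
move=> lt_b; have [|j jn rj] := IH s Es; first by rewrite -ltnS (leq_trans lt_b).
exists j.+1 => //=; split=> //; exists s; split=> //; split=> // u lt_su lt_ut Eu.
have /smax : u \in below r t.
  by rewrite mem_filter lt_ut Er // andbT; apply/asboolP.
by rewrite leNgt lt_su.
Qed.

End Breakpoints.

(** * Counting patterns of a semialgebraic family *)

Section VCDensity.
Variable R : rcfType.
Local Notation env := (nat -> R).
Implicit Types (e x b : env) (P Q E : env -> Prop) (B : seq env).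

Definition eglue N x b : env := fun i => if (i < N)%N then x i else b (i - N)%N.

(** Packs two parameters into one, so that attaching the extra parameter [b'] leaves the family in
    the form handled by [eglue]. *)
Definition interleave b b' : env := fun i => if odd i then b' i./2 else b i./2.

Lemma eglueS N x b : eglue N.+1 x b = econs (x 0%N) (eglue N (etail x) b).
Proof. by apply/funext => -[|i]. Qed.

Let even_part N i := (if i < N then i else N + (i - N).*2)%N.
Let odd_part N i := (if i < N then i else N + (i - N).*2.+1)%N.

Let eglue_even N x b b' :
  (fun i => eglue N x (interleave b b') (even_part N i)) = eglue N x b.
Proof.
apply/funext => i; rewrite /eglue /even_part; case: (ltnP i N) => [->//|le_Ni].
by rewrite ltnNge leq_addr /= addKn /interleave odd_double doubleK.
Qed.

Let eglue_odd N x b b' :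
  (fun i => eglue N x (interleave b b') (odd_part N i)) = eglue N x b'.
Proof.
apply/funext => i; rewrite /eglue /odd_part; case: (ltnP i N) => [->//|le_Ni].
by rewrite ltnNge leq_addr /= addKn /interleave /= odd_double uphalf_double.
Qed.

(* The first coordinate of the point enters the pattern only through the
   breakpoint immediately to its left, which is attached to a single [b']. *)
Lemma semialg_elim_coord N P : semialg P -> exists m (Q : nat -> env -> Prop),
  (forall i, semialg (Q i)) /\
  forall x B, B <> [::] -> exists i b', [/\ (i < m)%N, List.In b' B &
    forall b, List.In b B ->
      (P (eglue N.+1 x b) <-> Q i (eglue N (etail x) (interleave b b')))].
Proof.
move=> aP; have [E [K [aE fE cE]]] := semialg_breakpoints aP.
have pv := @polyfun_var R.
(* Three positions of the eliminated coordinate: at the breakpoint of rank [j] of [b'], to the right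
   of it with nothing in between, or to the left of all breakpoints. In the last two cases [P] is
   tested near the breakpoint or near minus infinity instead of at the coordinate itself. *)
pose Qat j e := exists t, rank_pt E j (econs t (fun i => e (odd_part N i))) /\
  P (econs t (fun i => e (even_part N i))).
pose Qgerm j e := exists t, rank_pt E j (econs t (fun i => e (odd_part N i))) /\
  exists s, t < s /\ forall u, t < u -> u < s -> P (econs u (fun i => e (even_part N i))).
pose Qinf e := exists s, forall u, u < s -> P (econs u (fun i => e (even_part N i))).
(* Index 0 is [Qinf], index [2j+1] is [Qgerm j] and index [2j+2] is [Qat j]; ranks run from 0 to
   [K]. *)
pose Q i := if i is j.+1 then if odd j then Qat j./2 else Qgerm j./2 else Qinf.
exists (K.+1.*2).+1, Q; split.
  have aat j : semialg (Qat j).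
    apply: semialg_ex; apply: semialg_and.
      by apply: (semialg_econs (fun i => (odd_part N i).+1)) => //; exact: semialg_rank_pt.
    exact: (semialg_econs (fun i => (even_part N i).+1)).
  have agerm j : semialg (Qgerm j).
    apply: semialg_ex; apply: semialg_and.
      by apply: (semialg_econs (fun i => (odd_part N i).+1)) => //; exact: semialg_rank_pt.
    apply: semialg_ex; apply: semialg_and; first exact: (semialg_lt (pv 1%N) (pv 0%N)).
    apply: semialg_all; apply: semialg_imp; first exact: (semialg_lt (pv 2%N) (pv 0%N)).
    apply: semialg_imp; first exact: (semialg_lt (pv 0%N) (pv 1%N)).
    exact: (semialg_econs (fun i => (even_part N i).+3)).
  case=> [|j] /=; last by case: ifP.
  apply: semialg_ex; apply: semialg_all; apply: semialg_imp.
    exact: (semialg_lt (pv 0%N) (pv 1%N)).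
  exact: (semialg_econs (fun i => (even_part N i).+2)).
move=> x B Bn0; set x' := etail x; set a := x 0%N.
have [b0 b0B] : exists b0, List.In b0 B by case: B Bn0 => // b0 B _; exists b0; left.
have [r rP] : exists r : seq R, forall b t, List.In b B ->
    E (econs t (eglue N x' b)) -> t \in r.
  elim: B {Bn0 b0B} => [|b B [r IH]]; first by exists [::].
  have [r' _ r'P] := fE (eglue N x' b); exists (r' ++ r) => b1 t [<-|b1B].
    by move=> /r'P; rewrite mem_cat => ->.
  by move=> /(IH _ _ b1B); rewrite mem_cat => ->; rewrite orbT.
pose isE t := exists2 b, List.In b B & E (econs t (eglue N x' b)).
(* Breakpoints of all parameters of [B] that do not exceed the coordinate [a]; the greatest one is
   kept. *)
pose low := [seq t <- r | (t <= a) && `[< isE t >]].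
have lowP t b : List.In b B -> E (econs t (eglue N x' b)) -> t <= a -> t \in low.
  move=> bB Et ta; rewrite mem_filter ta (rP _ _ bB Et) andbT /=.
  by apply/asboolP; exists b.
have PE b : P (eglue N.+1 x b) = P (econs a (eglue N x' b)) by rewrite eglueS.
have [low0|lown0] := eqVneq low [::].
  exists 0%N, b0; split=> // b bB; rewrite PE.
  have Pconst u : u <= a -> P (econs u (eglue N x' b)) <-> P (econs a (eglue N x' b)).
    move=> ua; apply: cE => // s /andP[_ sa] Es.
    by have := lowP _ _ bB Es sa; rewrite low0.
  rewrite /= /Qinf eglue_even; split=> [Pa|[s sP]].
    by exists a => u /ltW ua; apply/(Pconst u ua).
  apply/(Pconst (Num.min (s - 1) a)); first by rewrite ge_min lexx orbT.
  by apply: sP; rewrite gt_min ltrBlDr ltrDl ltr01.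
have [t tlow tmax] := seq_max lown0.
move: (tlow); rewrite mem_filter => /andP[/andP[ta /asboolP[b1 b1B Et]] _].
have [r' r'K r'P] := fE (eglue N x' b1).
have [j jr' rj] := rank_pt_exists r'P Et.
have jK : (j <= K)%N := leq_trans jr' r'K.
have [at_|t_lt_a] : t = a \/ t < a.
  by move: ta; rewrite le_eqVlt => /predU1P[]; [left|right].
  exists (j.*2.+2), b1; split=> [|//|b bB].
    by rewrite doubleS !ltnS leq_double.
  rewrite PE /= odd_double /= uphalf_double /Qat eglue_even eglue_odd -at_.
  by split=> [Pt|[s [/rank_pt_inj/(_ rj)->]]]; first by exists t.
exists (j.*2.+1), b1; split=> [|//|b bB].
  by rewrite doubleS !ltnS ltnW // ltnS leq_double.
rewrite PE /= odd_double doubleK /Qgerm eglue_even eglue_odd.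
(* By maximality of [t], no parameter of [B] has a breakpoint after [t] and up to [a]. *)
have Pconst u : t < u -> u <= a -> P (econs u (eglue N x' b)) <-> P (econs a (eglue N x' b)).
  move=> tu ua; apply: cE => // s /andP[us sa] Es.
  by have := tmax _ (lowP _ _ bB Es sa); rewrite leNgt (lt_le_trans tu us).
split=> [Pa|[s [/rank_pt_inj/(_ rj)-> [v [tv vP]]]]].
  exists t; split=> //; exists a; split=> // u tu /ltW ua.
  exact/(Pconst u tu ua).
have [w /andP[tw]] : exists w, t < w < Num.min v a.
  by exists ((t + Num.min v a) / 2); rewrite !midf_lt // lt_min tv.
by rewrite lt_min => /andP[wv wa]; apply/(Pconst w tw (ltW wa)); exact: vP.
Qed.

Definition pattern P N x B : seq bool := [seq `[< P (eglue N x b) >] | b <- B].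

Lemma semialg_pattern_count N P : semialg P -> exists c, forall B, B <> [::] ->
  exists2 L : seq (seq bool), (size L <= c * size B ^ N)%N &
    forall x, pattern P N x B \in L.
Proof.
elim: N P => [|N IH] P aP.
  exists 1%N => B _; exists [:: pattern P 0 (fun=> 0) B] => // x; rewrite inE.
  by apply/eqP/eq_map => b; congr asbool; congr P; apply/funext.
have [m [Q [aQ QP]]] := semialg_elim_coord N aP.
have /choice[c cP] : forall i, exists c, forall B, B <> [::] ->
  exists2 L : seq (seq bool), (size L <= c * size B ^ N)%N &
    forall x, pattern (Q i) N x B \in L by move=> i; exact: IH.
exists (\sum_(i < m) c i)%N => B Bn0.
pose Bof b' := [seq interleave b b' | b <- B].
have BofN0 b' : Bof b' <> [::] by case: B Bn0 @Bof.
have /choice[L LP] : forall ib : nat * env, exists L : seq (seq bool),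
    (size L <= c ib.1 * size B ^ N)%N /\
    forall x, pattern (Q ib.1) N x (Bof ib.2) \in L.
  move=> [i b']; have [L sL LP] := cP i (Bof b') (BofN0 b').
  by exists L; split=> //; move: sL; rewrite size_map.
(* One list for each index [i] and each owner [b'] of the breakpoint; the choice of [b'] in [B]
   costs the additional factor [size B]. *)
exists (flatten [seq L (i, b') | b' <- B, i <- iota 0 m]).
  rewrite size_flatten /shape map_allpairs sumnE big_allpairs_dep /=.
  rewrite expnS mulnCA.
  apply: (@leq_trans (\sum_(b' <- B) (\sum_(i < m) c i) * size B ^ N)%N); last first.
    by rewrite big_const_seq iter_addn_0 count_predT mulnC.
  apply: leq_sum => b' _; rewrite big_distrl /= -(big_mkord xpredT (fun i => c i * size B ^ N))%N.
  by rewrite /index_iota subn0; apply: leq_sum => i _; case: (LP (i, b')).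
move=> x; have [i [b' [im b'B Qi]]] := QP x B Bn0.
have [_ /(_ (etail x)) Lx] := LP (i, b').
have -> : pattern P N.+1 x B = pattern (Q i) N (etail x) (Bof b').
  rewrite /pattern /Bof -map_comp; elim: (B) Qi => //= b B' IHB Qi.
  rewrite (asbool_equiv_eq (Qi b (or_introl erefl))) IHB // => b1 b1B.
  by apply: Qi; right.
apply/flattenP; exists (L (i, b')) => //.
have imi : i \in iota 0 m by rewrite mem_iota.
elim: (B) b'B => //= b B' IHB [->|/IHB b'B]; rewrite mem_cat; last by rewrite b'B orbT.
by rewrite map_f.
Qed.

(** Distances involve square roots, which are not polynomial but have a semialgebraic graph;
    coordinate 0 holds the value. *)
Definition semialg_fun (f : env -> R) := semialg (fun e => e 0%N = f (etail e)).

Lemma semialg_fun_polyfun f : polyfun f -> semialg_fun f.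
Proof.
move=> pf; apply: semialg_eq (polyfun_var _ _) _.
by apply: (polyfun_comp (s := @etail R)) => // i; exact: polyfun_var.
Qed.

Lemma semialg_fun_graph f (s : nat -> nat) : semialg_fun f ->
  semialg (fun e => e (s 0%N) = f (fun i => e (s i.+1))).
Proof. exact: semialg_reindex. Qed.

(** The values of [f] and [g] are quantified existentially; under the quantifiers [u] is coordinate
    0, [t] coordinate 1 and the output coordinate 2. *)
Lemma semialg_funD f g : semialg_fun f -> semialg_fun g ->
  semialg_fun (fun e => f e + g e).
Proof.
have pv := @polyfun_var R; move=> af ag.
apply: (@eq_semialg _ (fun e => exists t, exists u,
  (t = f (etail e) /\ u = g (etail e)) /\ e 0%N = t + u)).
  by move=> e; split=> [[t [u [[-> ->]]]]//|->]; exists (f (etail e)), (g (etail e)).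
apply: semialg_ex; apply: semialg_ex; apply: semialg_and; last first.
  exact: (semialg_eq (pv 2%N) (polyfunD (pv 1%N) (pv 0%N))).
apply: semialg_and.
  exact: (semialg_fun_graph (fun i => if i is j.+1 then j.+3 else 1%N)).
exact: (semialg_fun_graph (fun i => if i is j.+1 then j.+3 else 0%N)).
Qed.

Lemma semialg_fun_sum I (r : seq I) (F : I -> env -> R) :
  (forall i, semialg_fun (F i)) -> semialg_fun (fun e => \sum_(i <- r) F i e).
Proof.
move=> aF; elim: r => [|i r IH].
  have -> : (fun e => \sum_(i <- [::]) F i e) = fun=> 0 by apply/funext => e; rewrite big_nil.
  exact/semialg_fun_polyfun/polyfun_cst.
have -> : (fun e => \sum_(i <- i :: r) F i e) = fun e => F i e + \sum_(i <- r) F i e.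
  by apply/funext => e; rewrite big_cons.
exact: semialg_funD.
Qed.

Lemma semialg_fun_sqrt f : polyfun f -> (forall e, 0 <= f e) ->
  semialg_fun (fun e => Num.sqrt (f e)).
Proof.
have pv := @polyfun_var R; move=> pf f0.
apply: (@eq_semialg _ (fun e => 0 <= e 0%N /\ e 0%N ^+ 2 = f (etail e))).
  move=> e; split=> [[e0 <-]|->]; first by rewrite sqrtr_sqr ger0_norm.
  by rewrite sqrtr_ge0 sqr_sqrtr.
apply: semialg_and; first exact: (semialg_le (polyfun_cst 0) (pv 0%N)).
apply: semialg_eq; first exact: polyfunX (pv 0%N).
by apply: (polyfun_comp (s := @etail R)) => // i; exact: polyfun_var.
Qed.

Lemma semialg_fun_lt f g : semialg_fun f -> semialg_fun g ->
  semialg (fun e => f e < g e).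
Proof.
have pv := @polyfun_var R; move=> af ag.
apply: (@eq_semialg _ (fun e => exists t, exists u, (t = f e /\ u = g e) /\ t < u)).
  by move=> e; split=> [[t [u [[-> ->]]]]//|?]; exists (f e), (g e).
apply: semialg_ex; apply: semialg_ex; apply: semialg_and; last first.
  exact: (semialg_lt (pv 1%N) (pv 0%N)).
apply: semialg_and.
  exact: (semialg_fun_graph (fun i => if i is j.+1 then j.+2 else 1%N)).
exact: (semialg_fun_graph (fun i => if i is j.+1 then j.+2 else 0%N)).
Qed.

End VCDensity.

(** * Upper bounds *)

Section OrderingCount.
Variables (R : realType) (d : nat).
Implicit Types (V : {mset 'rV[R]_d}%mset) (C : {fset 'rV[R]_d}) (c : 'rV[R]_d).

Lemma ordering_sorted V C :
  sorted (fun x y => dist_sum V x <= dist_sum V y) (ordering V C).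
Proof. by apply: sort_sorted => x y; exact: le_total. Qed.

(** One implication suffices: [V] compares any two distinct points of [C] strictly, so the two total
    preorders coincide on [C]. *)
Lemma eq_ordering V V' C : distinguishes V C ->
  {in C &, forall x y, dist_sum V x < dist_sum V y -> dist_sum V' x < dist_sum V' y} ->
  ordering V C = ordering V' C.
Proof.
move=> dV h.
have leh : {in C &, forall x y, dist_sum V x <= dist_sum V y = (dist_sum V' x <= dist_sum V' y)}.
  move=> x y xC yC; rewrite le_eqVlt; have [/eqP eD|nD] /= := boolP (_ == _).
    by rewrite (dV _ _ xC yC eD) lexx.
  have [lt_xy|le_yx] := ltP (dist_sum V x) (dist_sum V y); first by rewrite ltW // h.
  apply/esym/negbTE; rewrite -ltNge; apply: h => //.
  by rewrite lt_neqAle eq_sym nD.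
apply: (@sorted_eq_in _ (fun x y => dist_sum V x <= dist_sum V y)).
- by move=> y x z _ _ _; exact: le_trans.
- move=> x y; rewrite !mem_sort => xC yC /andP[le1 le2].
  by apply: dV => //; apply/eqP; rewrite eq_le le1.
- exact: ordering_sorted.
- have := ordering_sorted V' C; apply: (sub_in_sorted (P := mem C)).
    by move=> x y xC yC; rewrite leh.
  by apply/allP => x; rewrite mem_sort.
- by rewrite /ordering perm_sort perm_sym perm_sort.
Qed.

(** Choose one witness for each ordering; a statistic [pat] that determines all comparisons is
    injective on the chosen witnesses. *)
Lemma psi_le_patterns k C (T : eqType) (L : seq T) (pat : {mset 'rV[R]_d}%mset -> T) :
  (forall V, size V = k -> pat V \in L) ->
  (forall V V', size V = k -> size V' = k -> distinguishes V C ->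
    distinguishes V' C -> pat V = pat V' ->
    {in C &, forall x y, dist_sum V x < dist_sum V y -> dist_sum V' x < dist_sum V' y}) ->
  (psi k C <= size L)%N.
Proof.
move=> patL patP.
have /choice[W WP] : forall s : seq 'rV[R]_d, exists V : {mset 'rV[R]_d}%mset,
    s \in fset_set (Psi k C) -> [/\ size V = k, distinguishes V C & ordering V C = s].
  move=> s; have [|ns] := boolP (s \in fset_set (Psi k C)); last by exists (seq_mset [::]).
  by rewrite in_fset_set ?inE; [move=> [V [? ?] <-]; exists V|exact: finite_Psi].
rewrite /psi -(size_map (pat \o W)); apply: uniq_leq_size.
  rewrite map_inj_in_uniq ?fset_uniq // => s s' sP s'P /= e.
  have [sV dV <-] := WP s sP; have [sV' dV' <-] := WP s' s'P.
  by apply: eq_ordering => //; exact: patP.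
by move=> _ /mapP[s sP ->] /=; apply: patL; case: (WP s sP).
Qed.

End OrderingCount.

Lemma In_allpairs (A B : eqType) (T : Type) (f : A -> B -> T) s t x y :
  x \in s -> y \in t -> List.In (f x y) [seq f x y | x <- s, y <- t].
Proof.
move=> + yt; elim: s => // x' s IH; rewrite inE => /predU1P[<-|/IH xs] /=; last first.
  by rewrite List.in_app_iff; right.
rewrite List.in_app_iff; left; elim: t yt {IH} => // y' t IH.
by rewrite inE => /predU1P[<-|/IH yt]; [left|right].
Qed.

(** The point starts at offset [o] and vantage point [l] at offset [s l]; [s] may repeat an offset,
    which counts a vantage point twice. *)
Lemma semialg_dist_sum (R : rcfType) k d (o : nat) (s : nat -> nat) :
  semialg_fun (fun e : nat -> R =>
    \sum_(l < k) Num.sqrt (\sum_(i < d) (e (o + i)%N - e (s l + i)%N) ^+ 2)).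
Proof.
apply: semialg_fun_sum => l; apply: semialg_fun_sqrt => [|e].
  apply: polyfun_sum => i; apply: polyfunX.
  by apply: polyfunB; exact: polyfun_var.
by apply: sumr_ge0 => i _; exact: sqr_ge0.
Qed.

(** * The exponent [2dk] in every positive dimension *)

Section UpperBound.
Variables (R : realType) (d k : nat).
Implicit Types (V : {mset 'rV[R]_d}%mset) (C : {fset 'rV[R]_d}) (c v : 'rV[R]_d).

Definition rvcoord v i : R := if insub i is Some j then v ord0 j else 0.

Lemma rvcoordE v (i : 'I_d) : rvcoord v i = v ord0 i.
Proof. by rewrite /rvcoord valK. Qed.

Lemma euclid_norm_coord c v : euclid_norm (c - v) =
  Num.sqrt (\sum_(i < d) (rvcoord c i - rvcoord v i) ^+ 2).
Proof. by congr Num.sqrt; apply: eq_bigr => i _; rewrite !rvcoordE !mxE. Qed.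

Definition rvpair c c' i : R := if (i < d)%N then rvcoord c i else rvcoord c' (i - d)%N.

Lemma psi_upper : (0 < d)%N -> exists K, forall C, (0 < #|` C|)%N ->
  (psi k C <= K * #|` C| ^ (2 * d * k))%N.
Proof.
move=> d0; pose N := (k * d)%N.
(* An environment lists the [k] vantage points, [d] coordinates each, and then the two compared
   points at offsets [N] and [N + d]. *)
pose D (o : nat) (e : nat -> R) :=
  \sum_(l < k) Num.sqrt (\sum_(i < d) (e (N + o + i)%N - e (l * d + i)%N) ^+ 2).
pose P e : Prop := D 0%N e < D d e.
have aP : semialg P.
  by apply: semialg_fun_lt;
    exact: (semialg_dist_sum _ k d (N + _) (fun l => l * d)%N).
have [K KP] := semialg_pattern_count N aP; exists K => C C0.
pose B := [seq rvpair c c' | c <- enum_fset C, c' <- enum_fset C].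
pose xof (V : {mset 'rV[R]_d}%mset) i := rvcoord (nth 0 V (i %/ d)) (i %% d).
have sB : size B = (#|` C| ^ 2)%N by rewrite size_allpairs expnS expn1.
have BN0 : B <> [::].
  by move=> B0; move: sB; rewrite B0 => /esym/eqP; rewrite expn_eq0 (gtn_eqF C0).
have [L sL LP] := KP B BN0.
have PE V c c' : size V = k ->
    P (eglue N (xof V) (rvpair c c')) <-> dist_sum V c < dist_sum V c'.
  move=> sV; suff DE o y : (forall i, (i < d)%N -> rvpair c c' (o + i)%N = rvcoord y i) ->
      D o (eglue N (xof V) (rvpair c c')) = dist_sum V y.
    rewrite /P (DE 0%N c) ?(DE d c') // => i id; rewrite /rvpair ?id //.
    by rewrite ltnNge leq_addr addKn.
  move=> ho; rewrite /dist_sum (big_nth 0) sV big_mkord; apply: eq_bigr => l _.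
  rewrite euclid_norm_coord; congr Num.sqrt; apply: eq_bigr => i _.
  rewrite /eglue -addnA ltnNge leq_addr addKn /= ho //.
  have lN : (l * d + i < N)%N.
    rewrite /N (@leq_trans (l * d + d)%N) ?ltn_add2l //.
    by rewrite -mulSnr leq_mul2r ltn_ord orbT.
  by rewrite lN /xof divnMDl // divn_small // addn0 modnMDl modn_small.
have -> : (#|` C| ^ (2 * d * k) = size B ^ N)%N.
  by rewrite sB -expnM /N -mulnA [(d * k)%N]mulnC.
apply: leq_trans sL.
apply: (psi_le_patterns (pat := fun V => pattern P N (xof V) B)) => [V _|]; first exact: LP.
move=> V V' sV sV' _ _ /List.ext_in_map eqpat x y xC yC.
have /eqpat eP := In_allpairs (@rvpair) xC yC.
by move=> /(PE V x y sV)/asboolP; rewrite eP => /asboolP/(PE V' x y sV').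
Qed.

End UpperBound.

(** * The line with an even number of vantage points *)

Section MedianInterval.
Variable R : realDomainType.
Implicit Types (s L U : seq R) (x y p q : R).

Lemma balanced_split s m : size s = m.+1.*2 -> exists L U p q,
  [/\ perm_eq s (L ++ U ++ [:: p; q]), size L = m, size U = m, p <= q &
      {in L, forall u, u <= p} /\ {in U, forall u, q <= u}].
Proof.
move=> ss; pose w := sort <=%R s.
have sw : size w = m.+1.*2 by rewrite size_sort.
have m1 : (m.+1 < size w)%N by rewrite sw doubleS -addnn -addSn; lia.
have wE : w = take m w ++ w`_m :: w`_m.+1 :: drop m.+2 w.
  by rewrite -(drop_nth 0 m1) -drop_nth ?cat_take_drop // ltnW.
have : pairwise <=%R w by rewrite -sorted_pairwise ?sort_le_sorted //; exact: le_trans.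
rewrite wE pairwise_cat /= => /and3P[/allrelP aL _ /and3P[/andP[pq _] /allP aU _]].
exists (take m w), (drop m.+2 w), w`_m, w`_m.+1; split=> //.
- rewrite -(perm_sort <=%R) -/w {1}wE perm_cat2l.
  by rewrite -(cat1s w`_m) -(cat1s w`_m.+1) catA perm_catC.
- by rewrite size_takel // sw; lia.
- by rewrite size_drop sw; lia.
- by split=> u uw; [apply: aL => //; rewrite mem_head|apply: aU].
Qed.

(** Dropping absolute values with the signs fitting a point between [p] and [q] bounds the sum below
    by [S], which is independent of the point because [L] and [U] have equal size. Between [p] and
    [q] the bound is attained. *)
Lemma median_minimizes L U p q x y : size L = size U -> p <= x <= q ->
  {in L, forall u, u <= p} -> {in U, forall u, q <= u} ->
  \sum_(u <- L ++ U ++ [:: p; q]) `|x - u| <= \sum_(u <- L ++ U ++ [:: p; q]) `|y - u|.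
Proof.
move=> sLU /andP[px xq] Lp Uq; pose S := \sum_(u <- U) u - \sum_(u <- L) u + (q - p).
have SE z : S = \sum_(u <- L) (z - u) + \sum_(u <- U) (u - z) + (q - p).
  by rewrite !sumrB !big_const_seq !count_predT sLU /S; ring.
apply: (@le_trans _ _ S).
  rewrite (SE x) !big_cat !big_cons big_nil /= addr0 !addrA -!addrA.
  rewrite lerD //; first by rewrite !big_seq; apply: ler_sum => u /Lp up; rewrite ger0_norm; lra.
  rewrite lerD //; first by rewrite !big_seq; apply: ler_sum => u /Uq qu; rewrite ler0_norm; lra.
  by rewrite (@ger0_norm _ (x - p)) ?(@ler0_norm _ (x - q)); lra.
rewrite (SE y) !big_cat !big_cons big_nil /= addr0 !addrA -!addrA.
rewrite lerD //; first by apply: ler_sum => u _; exact: ler_norm.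
rewrite lerD //; first by apply: ler_sum => u _; rewrite distrC; exact: ler_norm.
by have := ler_norm (y - p); have := ler_norm (q - y); rewrite (distrC q); lra.
Qed.

End MedianInterval.

Section EvenLine.
Variables (R : realType) (m : nat).
Local Notation rv1 := 'rV[R]_1.
Implicit Types (V : {mset rv1}%mset) (C : {fset rv1}) (c x y : rv1).
Local Notation coord c := ((c : rv1) ord0 ord0).

Lemma euclid_norm1 x : euclid_norm x = `|coord x|.
Proof. by rewrite /euclid_norm big_ord1 sqrtr_sqr. Qed.

Lemma dist_sum1 V x : dist_sum V x = \sum_(u <- [seq coord v | v <- V]) `|coord x - u|.
Proof. by rewrite big_map; apply: eq_bigr => v _; rewrite euclid_norm1 !mxE. Qed.

Let collapsed (w : seq R) v (t : R) := \sum_(u <- w) `|t - u| + `|t - v| *+ 2.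

(* Merging the two median points into their midpoint [v] changes [dist_sum V]
   only between them, where [dist_sum V] is constant and minimal. *)
Let collapse_spec V (wpqv : seq R * R * R * R) := let: (w, p, q, v) := wpqv in
  [/\ size w = m.*2, p <= v <= q,
      forall x y, p <= coord x <= q -> dist_sum V x <= dist_sum V y &
      forall x, ~~ (p <= coord x <= q) -> dist_sum V x = collapsed w v (coord x)].

Let collapseP V : size V = m.+1.*2 -> exists wpqv, collapse_spec V wpqv.
Proof.
move=> sV; have : size [seq coord v | v <- V] = m.+1.*2 by rewrite size_map.
move=> /balanced_split[L [U [p [q [pV sL sU pq [Lp Uq]]]]]].
have DE x : dist_sum V x = \sum_(u <- L ++ U ++ [:: p; q]) `|coord x - u|.
  by rewrite dist_sum1 (perm_big _ pV).
exists (L ++ U, p, q, (p + q) / 2); split.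
- by rewrite size_cat sL sU addnn.
- by apply/andP; split; lra.
- by move=> x y pxq; rewrite !DE median_minimizes // sL sU.
- move=> x npxq; rewrite DE /collapsed catA big_cat !big_cons big_nil /= addr0.
  congr (_ + _); move: npxq; rewrite negb_and -!ltNge mulr2n => /orP[xp|qx].
    by rewrite !ltr0_norm; lra.
  by rewrite !gtr0_norm; lra.
Qed.

(** The statistic consists of the comparisons of collapsed distances, the side of the midpoint on
    which each point of [C] lies, and a three-valued type. The distance sum is constant on the
    median interval, so that interval contains at most one point of [C], and this point comes first;
    side and type identify it. Only [2m+1] real numbers enter. *)
Lemma psi_upper_even : exists K, forall C, (0 < #|` C|)%N ->
  (psi m.+1.*2 C <= K * #|` C| ^ (4 * m.+1 - 2))%N.
Proof.
pose N := m.*2.+1.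
(* Both [l = 2m] and [l = 2m+1] read slot [2m], so the midpoint stored there is counted twice. *)
pose D o (e : nat -> R) := \sum_(l < m.*2.+2)
  Num.sqrt (\sum_(i < 1) (e (o + i)%N - e (minn l m.*2 + i)%N) ^+ 2).
(* Coordinate [N + 2] is a flag: 0 compares two collapsed distances, 1 asks whether the first point
   is at most the midpoint. *)
pose P (e : nat -> R) : Prop := (e (N + 2)%N = 0 /\ D N e < D N.+1 e) \/
  (e (N + 2)%N = 1 /\ e N <= e m.*2).
have pv := @polyfun_var R.
have aP : semialg P.
  apply: semialg_or; apply: semialg_and; try exact: semialg_eq (pv _) (polyfun_cst _).
    by apply: semialg_fun_lt;
      exact: (semialg_dist_sum _ m.*2.+2 1 _ (fun l => minn l m.*2)).
  exact: semialg_le (pv _) (pv _).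
have [K KP] := semialg_pattern_count N aP.
(* The factor 3 counts the types, and [2 ^ N] comes from the two flag values, which double the
   parameter set. *)
exists (3 * (K * 2 ^ N))%N => C C0.
pose par z (c c' : rv1) (i : nat) : R :=
  if i is j.+1 then if j is _.+1 then z else coord c' else coord c.
pose Bz z := [seq par z c c' | c <- enum_fset C, c' <- enum_fset C].
pose B := Bz 0 ++ Bz 1.
have sB : size B = (2 * #|` C| ^ 2)%N by rewrite size_cat !size_allpairs addnn mul2n expnS expn1.
have BN0 : B <> [::].
  move=> B0; move: sB; rewrite B0 => /esym/eqP.
  by rewrite muln_eq0 expn_eq0 (gtn_eqF C0).
have [L sL LP] := KP B BN0.
have /choice[W WP] : forall V, exists wpqv, size V = m.+1.*2 -> collapse_spec V wpqv.
  move=> V; have [sV|nsV] := pselect (size V = m.+1.*2).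
    by have [wpqv ?] := collapseP sV; exists wpqv.
  by exists ([::], 0, 0, 0).
pose wof V := (W V).1.1.1; pose pof V := (W V).1.1.2.
pose qof V := (W V).1.2; pose vof V := (W V).2.
have WE V : W V = (wof V, pof V, qof V, vof V).
  by rewrite /wof /pof /qof /vof; case: (W V) => [[[]]].
pose xof V i := nth 0 (rcons (wof V) (vof V)) i.
pose mid V c := pof V <= coord c <= qof V.
(* [None] when no point of [C] is in the median interval, otherwise the side of the midpoint on
   which such a point lies. *)
pose ty V : option bool := if [pick c : C | mid V (val c)] is Some c
  then Some (coord (val c) <= vof V) else None.
pose L' := [seq (l, t) | l <- L, t <- [:: None; Some true; Some false]].
have -> : (3 * (K * 2 ^ N) * #|` C| ^ (4 * m.+1 - 2) = 3 * (K * size B ^ N))%N.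
  rewrite sB expnMn -expnM -!mulnA; congr (_ * (_ * (_ * _ ^ _)))%N.
  by rewrite /N; lia.
apply: (@leq_trans (size L')); last by rewrite size_allpairs /= mulnC leq_mul2l sL.
apply: (psi_le_patterns (pat := fun V => (pattern P N (xof V) B, ty V))).
  by move=> V _; apply: allpairs_f => //; case: (ty V) => [[]|].
have par_env V z c c' i : eglue N (xof V) (par z c c') (N + i)%N = par z c c' i.
  by rewrite /eglue ltnNge leq_addr addKn.
have DE V z c c' o : size V = m.+1.*2 -> (o < 2)%N ->
    D (N + o)%N (eglue N (xof V) (par z c c')) =
    collapsed (wof V) (vof V) (par z c c' o).
  move=> sV o2; have := WP V sV; rewrite WE => -[sw _ _ _].
  rewrite /D; under eq_bigr do rewrite big_ord1 sqrtr_sqr !addn0 par_env.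
  rewrite !big_ord_recr /= /collapsed -addrA mulr2n; congr (_ + (_ + _)).
  - rewrite (big_nth 0) sw big_mkord; apply: eq_bigr => l _; congr `|_ - _|.
    rewrite /eglue (minn_idPl (ltnW (ltn_ord l))) /N ltnS ltnW //.
    by rewrite /xof nth_rcons sw ltn_ord.
  - by rewrite minnn /eglue /N ltnSn /xof nth_rcons sw ltnn eqxx.
  - by rewrite (minn_idPr (leqnSn _)) /eglue /N ltnSn /xof nth_rcons sw ltnn eqxx.
have P0E V c c' : size V = m.+1.*2 -> P (eglue N (xof V) (par 0 c c')) <->
    collapsed (wof V) (vof V) (coord c) < collapsed (wof V) (vof V) (coord c').
  move=> sV; have := DE V 0 c c' 0%N sV isT; have := DE V 0 c c' 1%N sV isT.
  rewrite /P par_env addn1 addn0 => -> -> /=; split; last by left.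
  by move=> [[]//|[/eqP]]; rewrite eq_sym oner_eq0.
have P1E V c c' : size V = m.+1.*2 -> P (eglue N (xof V) (par 1 c c')) <->
    coord c <= vof V.
  move=> sV; rewrite /P par_env /=.
  have := par_env V 1 c c' 0%N; rewrite addn0 => ->.
  have -> : eglue N (xof V) (par 1 c c') m.*2 = vof V.
    have := WP V sV; rewrite WE => -[sw _ _ _].
    by rewrite /eglue /N ltnSn /xof nth_rcons sw ltnn eqxx.
  split; last by right.
  by move=> [[/eqP]|[]//]; rewrite oner_eq0.
move=> V V' sV sV' dV dV' [/List.ext_in_map eqpat eqty] x y xC yC.
have e0 : {in C &, forall x y,
    (collapsed (wof V) (vof V) (coord x) < collapsed (wof V) (vof V) (coord y)) ->
    (collapsed (wof V') (vof V') (coord x) < collapsed (wof V') (vof V') (coord y))}.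
  move=> c c' cC c'C; have /eqpat : List.In (par 0 c c') B.
    by apply/List.in_app_iff; left; exact: In_allpairs.
  by move=> eP /(P0E V c c' sV)/asboolP; rewrite eP => /asboolP/(P0E V' c c' sV').
have e1 : {in C, forall c, (coord c <= vof V) = (coord c <= vof V')}.
  move=> c cC; have /eqpat eP : List.In (par 1 c c) B.
    by apply/List.in_app_iff; right; exact: In_allpairs.
  by apply/idP/idP => [/(P1E V c c sV)/asboolP|/(P1E V' c c sV')/asboolP];
    [rewrite eP|rewrite -eP] => /asboolP; [move/(P1E V' c c sV')|move/(P1E V c c sV)].
have midU V0 : size V0 = m.+1.*2 -> distinguishes V0 C ->
    {in C &, forall c c', mid V0 c -> mid V0 c' -> c = c'}.
  move=> sV0 dV0 c c' cC c'C mc mc'; have := WP V0 sV0; rewrite WE => -[_ _ min _].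
  by apply: dV0 => //; apply/eqP; rewrite eq_le !min.
have vP V0 : size V0 = m.+1.*2 -> pof V0 <= vof V0 <= qof V0.
  by move=> sV0; have := WP V0 sV0; rewrite WE => -[].
(* If [c'] were left of [c], then, both being on the same side of the midpoints, one of them would
   lie between the other and a midpoint. One median interval would then contain two points of
   [C]. *)
have midE V1 V2 c c' : size V1 = m.+1.*2 -> size V2 = m.+1.*2 ->
    distinguishes V1 C -> distinguishes V2 C ->
    {in C, forall c, (coord c <= vof V1) = (coord c <= vof V2)} ->
    c \in C -> c' \in C -> mid V1 c -> mid V2 c' ->
    (coord c <= vof V1) = (coord c' <= vof V2) -> coord c <= coord c'.
  move=> s1 s2 d1 d2 e12 cC c'C mc mc' ecc'; rewrite leNgt; apply/negP => lt_c'c.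
  have /andP[p1 q1] := vP _ s1; have /andP[p2 q2] := vP _ s2.
  have /andP[pc cq] := mc; have /andP[pc' cq'] := mc'.
  have [le_cv|lt_vc] := leP (coord c) (vof V1).
    have mc2 : mid V2 c by move: le_cv; rewrite e12 // /mid => ?; apply/andP; split; lra.
    by move: lt_c'c; rewrite (midU V2 s2 d2 c c' cC c'C mc2 mc') ltxx.
  have mc1 : mid V1 c'.
    have : ~~ (coord c' <= vof V1) by rewrite e12 // -ecc' -ltNge.
    by rewrite -ltNge /mid => ?; apply/andP; split; lra.
  by move: lt_c'c; rewrite (midU V1 s1 d1 c c' cC c'C mc mc1) ltxx.
have emid : {in C, forall c, mid V c = mid V' c}.
  move: eqty; rewrite /ty; case: pickP => [c0 mc0|nV]; case: pickP => [c0' mc0'|nV'] // e c cC.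
    have c0E : val c0 = val c0'.
      apply/rowP => i; rewrite ord1; case: e => e; apply/eqP; rewrite eq_le.
      rewrite (midE V V') ?(midE V' V) ?(valP c0) ?(valP c0') //.
      by move=> c1 /e1.
    have [cc0|nc0] := eqVneq c (val c0); first by rewrite cc0 mc0 c0E mc0'.
    by apply/idP/idP => mc; case/eqP: nc0; [|rewrite c0E];
      [apply: (midU V)|apply: (midU V')] => //; exact: valP.
  by have := nV [` cC]%fset; have := nV' [` cC]%fset => /= -> ->.
have := WP V sV; have := WP V' sV'; rewrite !WE => -[_ _ min' out'] [_ _ min out] lt_xy.
have ne_xy : x <> y by move=> exy; move: lt_xy; rewrite exy ltxx.
(* A point [y] in the median interval is minimal and cannot exceed [x]; if [x] is there, it is
   minimal for [V'] too; if neither is, collapsed distances decide. *)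
have [my|nmy] := boolP (mid V y); first by move: lt_xy; rewrite ltNge min.
have [mx|nmx] := boolP (mid V x).
  rewrite lt_neqAle min' ?andbT; last by have := emid x xC; rewrite mx => /esym.
  by apply/eqP => /(dV' _ _ xC yC).
rewrite !out' -/(mid V' _) -?emid //; apply: e0 => //.
by rewrite -!out.
Qed.

End EvenLine.

(** * Euclidean geometry *)

Section Euclid.
Variables (R : realType) (d : nat).
Implicit Types (p q x h : 'rV[R]_d).

Definition dot p q : R := \sum_(i < d) p ord0 i * q ord0 i.

Definition unitv p : 'rV[R]_d := (euclid_norm p)^-1 *: p.

Lemma dotC p q : dot p q = dot q p.
Proof. by apply: eq_bigr => i _; rewrite mulrC. Qed.

Lemma dotDr p q h : dot p (q + h) = dot p q + dot p h.
Proof. by rewrite -big_split; apply: eq_bigr => i _; rewrite mxE mulrDr. Qed.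

Lemma dotZr (c : R) p q : dot p (c *: q) = c * dot p q.
Proof. by rewrite mulr_sumr; apply: eq_bigr => i _; rewrite mxE mulrCA. Qed.

Lemma dot0l p : dot 0 p = 0.
Proof. by apply: big1 => i _; rewrite mxE mul0r. Qed.

Lemma dotNr p q : dot p (- q) = - dot p q.
Proof. by rewrite -scaleN1r dotZr mulN1r. Qed.

Lemma dotBr p q h : dot p (q - h) = dot p q - dot p h.
Proof. by rewrite dotDr dotNr. Qed.

Lemma dotDl p q h : dot (p + q) h = dot p h + dot q h.
Proof. by rewrite dotC dotDr !(dotC h). Qed.

Lemma dotZl (c : R) p q : dot (c *: p) q = c * dot p q.
Proof. by rewrite dotC dotZr dotC. Qed.

Lemma dotBl p q h : dot (p - q) h = dot p h - dot q h.
Proof. by rewrite dotC dotBr !(dotC h). Qed.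

Lemma dotpp_ge0 p : 0 <= dot p p.
Proof. by apply: sumr_ge0 => i _; rewrite -expr2 sqr_ge0. Qed.

Lemma euclid_normE p : euclid_norm p = Num.sqrt (dot p p).
Proof. by congr Num.sqrt; apply: eq_bigr => i _; rewrite expr2. Qed.

Lemma euclid_norm_ge0 p : 0 <= euclid_norm p.
Proof. exact: sqrtr_ge0. Qed.

Lemma sqr_euclid_norm p : euclid_norm p ^+ 2 = dot p p.
Proof. by rewrite euclid_normE sqr_sqrtr // dotpp_ge0. Qed.

Lemma euclid_norm_eq0 p : (euclid_norm p == 0) = (p == 0).
Proof.
apply/idP/eqP => [|->]; last first.
  by rewrite euclid_normE dot0l sqrtr0.
rewrite -sqrf_eq0 sqr_euclid_norm psumr_eq0 => [/allP h|i _]; last first.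
  by rewrite -expr2 sqr_ge0.
apply/rowP => i; rewrite mxE; apply/eqP.
by have /implyP/(_ isT) := h i (mem_index_enum i); rewrite mulf_eq0 orbb.
Qed.

Lemma euclid_norm0 : euclid_norm (0 : 'rV[R]_d) = 0.
Proof. by apply/eqP; rewrite euclid_norm_eq0. Qed.

Lemma euclid_norm_gt0 p : (0 < euclid_norm p) = (p != 0).
Proof. by rewrite lt0r euclid_norm_eq0 euclid_norm_ge0 andbT. Qed.

Lemma euclid_normZ (c : R) p : euclid_norm (c *: p) = `|c| * euclid_norm p.
Proof.
by rewrite !euclid_normE dotZl dotZr mulrA -expr2 sqrtrM ?sqr_ge0 // sqrtr_sqr.
Qed.

Lemma euclid_normN p : euclid_norm (- p) = euclid_norm p.
Proof. by rewrite -scaleN1r euclid_normZ normrN1 mul1r. Qed.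

Lemma unitv0 : unitv 0 = 0.
Proof. exact: scaler0. Qed.

Lemma euclid_norm_unitv p : p != 0 -> euclid_norm (unitv p) = 1.
Proof.
by move=> p0; rewrite euclid_normZ ger0_norm ?invr_ge0 ?euclid_norm_ge0 //
  mulVf // euclid_norm_eq0.
Qed.

Lemma dot_unitv p : dot (unitv p) p = euclid_norm p.
Proof.
have [->|p0] := eqVneq p 0; first by rewrite dotC dot0l euclid_norm0.
by rewrite dotZl -sqr_euclid_norm expr2 mulKf // euclid_norm_eq0.
Qed.

Lemma dot_le p q : dot p q <= euclid_norm p * euclid_norm q.
Proof.
have [->|p0] := eqVneq p 0; first by rewrite dot0l euclid_norm0 mul0r.
have [->|q0] := eqVneq q 0; first by rewrite dotC dot0l euclid_norm0 mulr0.
have := dotpp_ge0 (euclid_norm q *: p - euclid_norm p *: q).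
rewrite dotBl !dotBr !dotZl !dotZr -!sqr_euclid_norm (dotC q p).
move: p0 q0; rewrite -!euclid_norm_gt0.
move: (euclid_norm p) (euclid_norm q) (dot p q) => s t c s0 t0 h.
have st0 : 0 < s * t by rewrite mulr_gt0.
rewrite -(ler_pM2l st0); nra.
Qed.

Lemma normr_dot_le p q : `|dot p q| <= euclid_norm p * euclid_norm q.
Proof. by rewrite ler_norml dot_le andbT lerNl -dotNr -(euclid_normN q) dot_le. Qed.

Lemma euclid_normD p q : euclid_norm (p + q) <= euclid_norm p + euclid_norm q.
Proof.
rewrite -ler_sqr ?nnegrE ?addr_ge0 ?euclid_norm_ge0 // sqr_euclid_norm.
rewrite dotDl !dotDr -!sqr_euclid_norm (dotC q p) sqrrD.
by have := dot_le p q; lra.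
Qed.

(** Subgradient inequality, by Cauchy-Schwarz against a unit vector. It survives at [p = 0], where
    [unitv] gives the subgradient 0. *)
Lemma euclid_normD_ge p q : euclid_norm p + dot (unitv p) q <= euclid_norm (p + q).
Proof.
have [->|p0] := eqVneq p 0.
  by rewrite unitv0 dot0l euclid_norm0 !add0r euclid_norm_ge0.
rewrite -{1}(dot_unitv p) -dotDr; apply: le_trans (dot_le _ _) _.
by rewrite euclid_norm_unitv // mul1r.
Qed.

(* AM-GM: [|p + q| <= (|p + q|^2 + |p|^2) / (2 |p|)] *)
Lemma euclid_normD_le p q : p != 0 -> euclid_norm (p + q) <=
  euclid_norm p + dot (unitv p) q + euclid_norm q ^+ 2 / euclid_norm p.
Proof.
rewrite -euclid_norm_gt0 => p0.
have q0 : 0 <= euclid_norm q ^+ 2 by rewrite sqr_ge0.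
have h : euclid_norm (p + q) ^+ 2 = euclid_norm p ^+ 2 + 2 * dot p q + euclid_norm q ^+ 2.
  by rewrite !sqr_euclid_norm dotDl !dotDr (dotC q p); ring.
rewrite dotZl -(ler_pM2l p0) !mulrDr mulrA divff ?gt_eqF // mul1r.
rewrite [_ * (_ ^+ 2 / _)]mulrC divfK ?gt_eqF //.
have := sqr_ge0 (euclid_norm (p + q) - euclid_norm p).
by rewrite sqrrB h -!expr2; move: q0; lra.
Qed.

(** The direction turns by at most [2|q|/|p|]: one half from the displacement, one half from the
    change of normalization. *)
Lemma dot_unitvD p q h : p != 0 -> p + q != 0 ->
  `|dot (unitv (p + q)) h - dot (unitv p) h| <=
  2 * euclid_norm q / euclid_norm p * euclid_norm h.
Proof.
rewrite -!euclid_norm_gt0 => p0 pq0; rewrite -dotBl.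
apply: le_trans (normr_dot_le _ _) _; rewrite ler_wpM2r ?euclid_norm_ge0 //.
have -> : unitv (p + q) - unitv p =
    ((euclid_norm (p + q))^-1 - (euclid_norm p)^-1) *: (p + q) + (euclid_norm p)^-1 *: q.
  by rewrite /unitv scalerBl scalerDr [in RHS](scalerDr (euclid_norm p)^-1) opprD -!addrA addNr addr0.
apply: le_trans (euclid_normD _ _) _; rewrite !euclid_normZ.
rewrite -[X in _ * X + _](ger0_norm (ltW pq0)) -normrM mulrBl mulVf ?gt_eqF //.
rewrite -{1}(@mulVf _ (euclid_norm p)) ?gt_eqF // -mulrBr normrM.
rewrite (@ger0_norm _ (euclid_norm p)^-1) ?invr_ge0 ?(ltW p0) // -mulrDr.
rewrite [leLHS]mulrC ler_pM2r ?invr_gt0 // -[2]/(1 + 1) mulrDl mul1r lerD2r.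
rewrite ler_norml; apply/andP; split.
  by have := euclid_normD p q; lra.
by have := euclid_normD (p + q) (- q); rewrite addrK euclid_normN; lra.
Qed.

End Euclid.

(** * Lower bound from transversal pairs *)

Section LowerBound.
Variables (R : realType) (d k : nat).
Implicit Types (v h a b : nat -> 'rV[R]_d) (x w : 'rV[R]_d).

Definition vdist v x : R := \sum_(l < k) euclid_norm (x - v l).

(* First-order variation of [vdist v x] when each [x - v l] moves along [z l]. *)
Definition vgrad v x (z : nat -> 'rV[R]_d) : R :=
  \sum_(l < k) dot (unitv (x - v l)) (z l).

(** Away from the vantage points [vdist v] is differentiable; the second clause says that its
    gradient is nonzero, with [w] normalized to unit growth. *)
Definition regular_point v x := (forall l, (l < k)%N -> x <> v l) /\
  exists w, vgrad v x (fun=> w) = 1.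

Definition level_pair v x y :=
  [/\ regular_point v x, regular_point v y & vdist v x = vdist v y].

(** Distinct levels let zeroth-order terms settle comparisons between different pairs; the last
    clause is linear independence of the gradient differences, stated as surjectivity. *)
Definition transversal_pairs r v a b :=
  [/\ forall g, (g < r)%N -> level_pair v (a g) (b g),
      forall g g', (g < r)%N -> (g' < r)%N ->
        vdist v (a g) = vdist v (a g') -> g = g' &
      forall y : nat -> R, exists h, forall g, (g < r)%N ->
        vgrad v (a g) h - vgrad v (b g) h = y g].

(** Each summand is squeezed between the subgradient bound and the quadratic upper bound on the norm
    of a sum. *)
Lemma vdist_expand v x h w : (forall l, (l < k)%N -> x <> v l) ->
  exists2 M, 0 <= M & forall e : R,
    `|vdist (fun l => v l + e *: h l) (x + e *: w) - vdist v x
      - e * vgrad v x (fun l => w - h l)| <= M * e ^+ 2.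
Proof.
move=> xv; exists (\sum_(l < k) euclid_norm (w - h l) ^+ 2 / euclid_norm (x - v l)).
  by apply: sumr_ge0 => l _; rewrite divr_ge0 ?sqr_ge0 ?euclid_norm_ge0.
move=> e; rewrite /vdist /vgrad -sumrB mulr_sumr -sumrB mulr_suml.
apply: le_trans (ler_norm_sum _ _ _) _; apply: ler_sum => l _.
have pn0 : x - v l != 0 by rewrite subr_eq0; apply/eqP/xv.
have -> : x + e *: w - (v l + e *: h l) = (x - v l) + e *: (w - h l).
  by rewrite scalerBr; apply/rowP => i; rewrite !mxE; ring.
have := euclid_normD_ge (x - v l) (e *: (w - h l)).
have := euclid_normD_le (e *: (w - h l)) pn0.
rewrite dotZr euclid_normZ exprMn real_normK ?num_real // => hle hge.
by rewrite ger0_norm ?[_ * e ^+ 2]mulrC ?mulrA; lra.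
Qed.

(** For small [e] the comparison is lexicographic, levels first and first variations second, because
    the remaining error is quadratic. *)
Lemma near_vdist_lt v x x' h w w' :
  (forall l, (l < k)%N -> x <> v l) -> (forall l, (l < k)%N -> x' <> v l) ->
  vdist v x < vdist v x' \/ vdist v x = vdist v x' /\
    vgrad v x (fun l => w - h l) < vgrad v x' (fun l => w' - h l) ->
  \forall e \near (0 : R)^'+, vdist (fun l => v l + e *: h l) (x + e *: w) <
    vdist (fun l => v l + e *: h l) (x' + e *: w').
Proof.
move=> xv xv'; have [M M0 hM] := vdist_expand h w xv.
have [M' M'0 hM'] := vdist_expand h w' xv'.
set D := vdist v x; set D' := vdist v x'.
set c := vgrad v x _; set c' := vgrad v x' _.
have bound e : D' - D + e * (c' - c) - (M + M') * e ^+ 2 <=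
    vdist (fun l => v l + e *: h l) (x' + e *: w') -
    vdist (fun l => v l + e *: h l) (x + e *: w).
  have := hM e; have := hM' e; rewrite !ler_norml -/D -/D' -/c -/c'.
  by move=> /andP[h1 _] /andP[_ h2]; rewrite mulrDl mulrBr; lra.
move=> hlt.
suff : \forall e \near (0 : R)^'+, 0 < D' - D + e * (c' - c) - (M + M') * e ^+ 2.
  by apply: filterS => e h0; rewrite -subr_gt0 (lt_le_trans h0).
case: hlt => [lt_DD'|[eqD lt_cc']].
  (* For [e] below 1 and [q], the linear and quadratic terms together stay below the gap between the
     levels. *)
  pose q := (D' - D) / (`|c' - c| + M + M' + 1).
  have den : 0 < `|c' - c| + M + M' + 1.
    by rewrite ltr_wpDl // !addr_ge0.
  have q0 : 0 < q by rewrite divr_gt0 // subr_gt0.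
  near=> e.
  have e0 : 0 < e by near: e; exact: nbhs_right_gt.
  have e1 : e < 1 by near: e; exact: nbhs_right_lt.
  have eq : e < q by near: e; exact: nbhs_right_lt.
  have : e * (`|c' - c| + M + M' + 1) < D' - D by rewrite -ltr_pdivlMr.
  have h1 : - (e * `|c' - c|) <= e * (c' - c).
    by rewrite -mulrN ler_pM2l // lerNl -normrN ler_norm.
  have h2 : (M + M') * e ^+ 2 <= (M + M') * e.
    by rewrite ler_wpM2l ?addr_ge0 // expr2 ler_piMl ?(ltW e0) ?(ltW e1).
  by move: h1 h2; rewrite !mulrDr !mulrDl !mulr1 (mulrC e M) (mulrC e M'); lra.
pose q := (c' - c) / (M + M' + 1).
have den : 0 < M + M' + 1 by rewrite ltr_wpDl // addr_ge0.
have q0 : 0 < q by rewrite divr_gt0 // subr_gt0.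
near=> e.
have e0 : 0 < e by near: e; exact: nbhs_right_gt.
have eq : e < q by near: e; exact: nbhs_right_lt.
have h1 : e * (M + M' + 1) < c' - c by rewrite -ltr_pdivlMr.
have : 0 < e * (c' - c - e * (M + M' + 1)) by rewrite mulr_gt0 // subr_gt0.
have : 0 < e * e by rewrite mulr_gt0.
by rewrite eqD subrr add0r expr2; lra.
Unshelve. all: by end_near. Qed.

Lemma ordering_lt (V V' : {mset 'rV[R]_d}%mset) (C : {fset 'rV[R]_d}) x y :
  ordering V C = ordering V' C -> x \in C -> y \in C ->
  dist_sum V x < dist_sum V y -> dist_sum V' x <= dist_sum V' y.
Proof.
move=> eqo xC yC lt_xy; set s := ordering V C in eqo.
have xs : x \in s by rewrite mem_sort.
have ys : y \in s by rewrite mem_sort.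
have tr W : transitive (fun x y => dist_sum W x <= dist_sum W y :> R).
  by move=> ? ? ?; exact: le_trans.
have rf W : reflexive (fun x y => dist_sum W x <= dist_sum W y :> R) by move=> ?; exact: lexx.
have := sorted_leq_index (tr V') (rf V') (ordering_sorted V' C) x y.
rewrite -eqo; apply=> //; rewrite leqNgt; apply/negP => lt_ix.
have := sorted_leq_index (tr V) (rf V) (ordering_sorted V C) y x ys xs (ltnW lt_ix).
by rewrite leNgt lt_xy.
Qed.

Lemma dist_sum_seq_mset v x : dist_sum (seq_mset (mkseq v k)) x = vdist v x.
Proof.
rewrite /dist_sum (perm_big _ (perm_eq_seq_mset _)) big_map /vdist.
by rewrite -(big_mkord xpredT (fun l => euclid_norm (x - v l))) /index_iota subn0.
Qed.

(** Each function [y] moves the vantage points so that point [z] of the cluster at [a g] precedes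
    point [z'] of the cluster at [b g] exactly when [y g <= z + p * z']. The right-hand sides take
    all [p ^ 2] values, so different [y] give different orderings. *)
Lemma psi_lower r v a b p n : transversal_pairs r v a b ->
  (0 < r)%N -> (0 < p)%N -> (2 * r * p <= n)%N ->
  exists2 C : {fset 'rV[R]_d}, #|` C| = n & ((p ^ 2) ^ r <= psi k C)%N.
Proof.
move=> [pairP lev_inj surj] r0 p0 rpn.
(* Clusters at [a g], clusters at [b g], and fillers that bring the number of points to exactly
   [n]. *)
pose I := ('I_r * 'I_p + 'I_r * 'I_p + 'I_(n - 2 * r * p))%type.
have cardI : #|{: I}| = n by rewrite !card_sum !card_prod !card_ord; lia.
pose Y := {ffun 'I_r -> 'I_(p ^ 2)}.
pose yv (y : Y) g : R := if insub g is Some g' then (y g')%:R else 0.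
have yvE (y : Y) (g : 'I_r) : yv y g = (y g)%:R by rewrite /yv valK.
(* The shift by one half keeps thresholds off the integers and so excludes ties. *)
have /choice[hh hhP] : forall y : Y, exists h, forall g, (g < r)%N ->
    vgrad v (a g) h - vgrad v (b g) h = 2^-1 - yv y g.
  by move=> y; exact: surj.
have /choice[dir dirP] : forall x, exists w, regular_point v x -> vgrad v x (fun=> w) = 1.
  move=> x; have [[xv [w hw]]|?] := pselect (regular_point v x); first by exists w.
  by exists 0.
pose grp (i : I) : nat := match i with
  inl (inl (g, _)) => g | inl (inr (g, _)) => g | inr _ => 0%N end.
pose base (i : I) := match i with
  inl (inl (g, _)) => a g | inl (inr (g, _)) => b g | inr _ => a 0%N end.
(* The offsets make [z] and [z'] the base-[p] digits of [z + p * z']; fillers continue the cluster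
   at [a 0] beyond its [p] points. *)
pose off (i : I) : R := match i with
  inl (inl (_, z)) => - z%:R | inl (inr (_, z)) => (p * z)%:R | inr z => - (p + z)%:R end.
pose kap (y : Y) i := off i - vgrad v (base i) (hh y).
have grp_lt i : (grp i < r)%N by case: i => [[[g z]|[g z]]|z] /=.
have baseP i : regular_point v (base i).
  by case: i => [[[g z]|[g z]]|z] /=; have [] := pairP _ r0; try have [] := pairP g (ltn_ord g).
have levE i : vdist v (base i) = vdist v (a (grp i)).
  by case: i => [[[g z]|[g z]]|z] //=; have [_ _ ->] := pairP g (ltn_ord g).
have kapE y i : vgrad v (base i) (fun l => off i *: dir (base i) - hh y l) = kap y i.
  rewrite /kap /vgrad; under eq_bigr do rewrite dotBr dotZr.
  by rewrite sumrB -mulr_sumr -/(vgrad v _ (fun=> _)) dirP // mulr1.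
pose lt y i i' := vdist v (base i) < vdist v (base i') \/
  vdist v (base i) = vdist v (base i') /\ kap y i < kap y i'.
have half_int (s t : int) : (s%:~R + 2^-1 != t%:~R :> R).
  apply/eqP => h; have : ((s * 2 + 1)%:~R = (t * 2)%:~R :> R).
    by rewrite rmorphD !rmorphM /= -h mulrDl mulVf ?pnatr_eq0.
  by move=> /eqP; rewrite eqr_int; lia.
have kap_neq y i i' : grp i = grp i' -> kap y i = kap y i' -> i = i'.
  have cross (g : 'I_r) (z z' : nat) : - z%:R - vgrad v (a g) (hh y) <> z'%:R - vgrad v (b g) (hh y).
    move=> e; have := half_int z' (- (z : int) + y g)%R; rewrite rmorphD rmorphN /= -!pmulrn -yvE.
    by move=> /eqP; apply; have := hhP y g (ltn_ord g); lra.
  have inj_nat (z z' : nat) (s : R) : z%:R - s = z'%:R - s -> z = z'.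
    by move=> /addIr/eqP; rewrite eqr_nat => /eqP.
  have inj_natN (z z' : nat) (s : R) : - z%:R - s = - z'%:R - s -> z = z'.
    by move=> /addIr/oppr_inj/eqP; rewrite eqr_nat => /eqP.
  case: i i' => [[[g z]|[g z]]|z] [[[g' z']|[g' z']]|z'] /=; rewrite /kap /=.
  - by move=> /ord_inj<- /inj_natN/ord_inj->.
  - by move=> /ord_inj<- /cross.
  - by move=> g0; rewrite g0 => /inj_natN zz; have := ltn_ord z; rewrite zz ltnNge leq_addr.
  - by move=> /ord_inj<- /esym/cross.
  - by move=> /ord_inj<- /inj_nat/eqP; rewrite eqn_pmul2l // => /eqP/ord_inj->.
  - by move=> g0; rewrite -(congr1 a g0) => /esym/cross.
  - by move=> g0; rewrite -g0 => /inj_natN zz; have := ltn_ord z'; rewrite -zz ltnNge leq_addr.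
  - by move=> g0; rewrite (congr1 a g0) => /cross.
  - by move=> _ /inj_natN/addnI/ord_inj->.
have lt_total y i i' : i <> i' -> lt y i i' \/ lt y i' i.
  move=> ii'; rewrite /lt; have [?|?|eD] := ltgtP (vdist v (base i)) (vdist v (base i')).
  - by left; left.
  - by right; left.
  - have eg : grp i = grp i' by apply: lev_inj; rewrite -?levE.
    have [?|?|/(kap_neq y _ _ eg)//] := ltgtP (kap y i) (kap y i'); first by left; right.
    by right; right.
pose pt e i := base i + e *: (off i *: dir (base i)).
pose vv e y := (fun l => v l + e *: hh y l).
(* One scale [e] serves all of the finitely many [y], so the same point set is used for every
   ordering. *)
have : \forall e \near (0 : R)^'+, forall (y : Y) i i', lt y i i' ->
    vdist (vv e y) (pt e i) < vdist (vv e y) (pt e i').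
  apply: filter_forall => y; apply: filter_forall => i; apply: filter_forall => i'.
  have [ltii'|nlt] := pselect (lt y i i'); last by apply: filterE => e /nlt.
  have := @near_vdist_lt v (base i) (base i') (hh y) (off i *: dir (base i))
    (off i' *: dir (base i')) (baseP i).1 (baseP i').1.
  rewrite !kapE => /(_ ltii'); apply: filterS => e + _; exact.
move=> /filter_ex[e eP].
pose V y := seq_mset (mkseq (vv e y) k).
have VE y x : dist_sum (V y) x = vdist (vv e y) x by exact: dist_sum_seq_mset.
have p20 : (0 < p ^ 2)%N by rewrite expn_gt0 p0.
have VptI (y : Y) i i' : dist_sum (V y) (pt e i) = dist_sum (V y) (pt e i') -> i = i'.
  move=> eD; apply: contrapT => /(lt_total y)[]/eP; rewrite -!VE eD ltxx //.
have pt_inj : injective (pt e).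
  by move=> i i' eqp; apply: (VptI [ffun=> Ordinal p20]); rewrite eqp.
pose C := [fset x in map (pt e) (enum {: I})]%fset.
have CP x : x \in C -> exists i, x = pt e i by rewrite !inE => /mapP[i _ ->]; exists i.
have ptC i : pt e i \in C by rewrite !inE map_f ?mem_enum.
exists C.
  rewrite card_fseq undup_id; first by rewrite size_map -cardE cardI.
  by rewrite map_inj_uniq ?enum_uniq.
have dV y : distinguishes (V y) C.
  by move=> _ _ /CP[i ->] /CP[i' ->] /VptI->.
have sV y : size (V y) = k by rewrite (perm_size (perm_eq_seq_mset _)) size_mkseq.
have ord_inj : injective (fun y => ordering (V y) C).
  suff h y y' (g : 'I_r) : ordering (V y) C = ordering (V y') C -> (y' g <= y g)%N.
    move=> y y' eqo; apply/ffunP => g; apply/val_inj/eqP.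
    by rewrite eqn_leq (h _ _ _ eqo) (h _ _ _ (esym eqo)).
  move=> eqo; rewrite leqNgt; apply/negP => lt_yy'.
  have yp : (y g < p * p)%N by rewrite (leq_trans (ltn_ord (y g))) // expnS expn1.
  (* The digits of [y g] select two points that [y] and [y'] put in opposite orders. *)
  pose i : I := inl (inl (g, Ordinal (ltn_pmod (y g) p0))).
  have zp : (y g %/ p < p)%N by rewrite ltn_divLR.
  pose i' : I := inl (inr (g, Ordinal zp)).
  have eD : vdist v (base i) = vdist v (base i') by rewrite !levE.
  have ygE : (p * (y g %/ p))%:R + (y g %% p)%:R = (y g)%:R :> R.
    by rewrite -natrD mulnC -divn_eq.
  have lt1 : lt y i i'.
    right; split=> //; rewrite /kap /=.
    by have := hhP y g (ltn_ord g); rewrite yvE; move: ygE; lra.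
  have lt2 : lt y' i' i.
    right; split=> //; rewrite /kap /=.
    have : (y g)%:R + 1 <= (y' g)%:R :> R by rewrite natr1 ler_nat.
    by have := hhP y' g (ltn_ord g); rewrite yvE; move: ygE; lra.
  have := ordering_lt eqo (ptC i) (ptC i'); rewrite !VE => /(_ (eP _ _ _ lt1)).
  by rewrite leNgt eP.
have -> : ((p ^ 2) ^ r = size [seq ordering (V y) C | y <- enum {: Y}])%N.
  by rewrite size_map -cardE card_ffun !card_ord.
rewrite /psi; apply: uniq_leq_size; first by rewrite map_inj_uniq ?enum_uniq.
move=> _ /mapP[y _ ->]; rewrite in_fset_set ?inE; last exact: finite_Psi.
by exists (V y).
Qed.

End LowerBound.

(** * Transversal pairs in dimension at least two *)

Section PairsNearVantagePoint.
Variables (R : realType) (d k : nat).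
Implicit Types (v h : nat -> 'rV[R]_d) (t : 'rV[R]_d).

Lemma continuous_euclid_norm_ray (p t : 'rV[R]_d) :
  continuous (fun s : R => euclid_norm (p + s *: t) : R).
Proof.
have -> : (fun s : R => euclid_norm (p + s *: t)) =
    Num.sqrt \o (fun s => dot p p + 2 * dot p t * s + dot t t * s ^+ 2).
  apply/funext => s /=; rewrite euclid_normE; congr Num.sqrt.
  by rewrite dotDl !dotDr !dotZl !dotZr (dotC t p); ring.
move=> s; apply: continuous_comp; last exact: sqrt_continuous.
apply: cvgD; last by apply: cvgMr; exact: exprn_continuous.
apply: cvgD; first exact: cvg_cst.
by apply: cvgMr; exact: cvg_id.
Qed.

Lemma continuous_vdist_ray v x t :
  continuous (fun s : R => vdist k v (x + s *: t) : R).
Proof.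
move=> s; rewrite /vdist; apply: cvg_big => [|l _]; first exact: add_continuous.
have -> : (fun s : R => euclid_norm (x + s *: t - v l)) =
    (fun s : R => euclid_norm (x - v l + s *: t)).
  by apply/funext => u; rewrite addrAC.
rewrite addrAC; exact: continuous_euclid_norm_ray.
Qed.

Lemma vgradZ v x (c : R) h : vgrad k v x (fun l => c *: h l) = c * vgrad k v x h.
Proof. by rewrite /vgrad mulr_sumr; apply: eq_bigr => l _; rewrite dotZr. Qed.

Lemma vgradD v x h h' :
  vgrad k v x (fun l => h l + h' l) = vgrad k v x h + vgrad k v x h'.
Proof. by rewrite /vgrad -big_split; apply: eq_bigr => l _; rewrite dotDr. Qed.

(* The junk value [unitv 0 = 0] makes [vgrad] ignore the vantage point located
   at [x] itself. *)
Lemma vdist_ge v x t : vdist k v x + vgrad k v x (fun=> t) <= vdist k v (x + t).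
Proof.
rewrite /vdist /vgrad -big_split; apply: ler_sum => l _.
by rewrite addrAC; exact: euclid_normD_ge.
Qed.

(** The term of [v j] contributes exactly [s], and by convexity the other terms together do not
    decrease. *)
Lemma vdist_ray_ge v j t (s : R) : (j < k)%N -> euclid_norm t = 1 ->
  0 <= vgrad k v (v j) (fun=> t) -> 0 <= s ->
  vdist k v (v j) + s <= vdist k v (v j + s *: t).
Proof.
move=> jk t1 gt s0.
apply: (@le_trans _ _ (vdist k v (v j) + vgrad k v (v j) (fun=> s *: t) + s)).
  by rewrite (vgradZ v (v j) s (fun=> t)) lerD2r lerDl mulr_ge0.
rewrite /vdist /vgrad (bigD1 (Ordinal jk)) //= [X in _ + X + _](bigD1 (Ordinal jk)) //=.
rewrite [leRHS](bigD1 (Ordinal jk)) //=.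
have -> : v j + s *: t - v j = s *: t by rewrite addrAC subrr add0r.
rewrite subrr euclid_norm0 unitv0 dot0l !add0r.
rewrite euclid_normZ t1 mulr1 ger0_norm // [leRHS]addrC lerD2r -big_split.
by apply: ler_sum => l _; rewrite addrAC; exact: euclid_normD_ge.
Qed.

(** The intermediate value theorem reaches the level [e] above that of [v j] within distance [e],
    since growth has rate at least 1; this is too short to meet another vantage point. *)
Lemma ray_regular v j t (e : R) : (j < k)%N -> euclid_norm t = 1 ->
  0 <= vgrad k v (v j) (fun=> t) -> 0 < e ->
  (forall l, (l < k)%N -> l <> j -> e < euclid_norm (v j - v l)) ->
  exists s, [/\ 0 < s, s <= e, vdist k v (v j + s *: t) = vdist k v (v j) + e &
    regular_point k v (v j + s *: t)].
Proof.
move=> jk t1 gt e0 ev.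
have ray0 : vdist k v (v j + 0 *: t) = vdist k v (v j) by rewrite scale0r addr0.
have ge_e := vdist_ray_ge jk t1 gt (ltW e0).
have [s] : exists2 s, s \in `[0, e]%R & vdist k v (v j + s *: t) = vdist k v (v j) + e.
  apply: IVT; first exact: ltW.
    exact/continuous_subspaceT/continuous_vdist_ray.
  by rewrite ray0 ge_min lerDl (ltW e0) le_max ge_e orbT.
rewrite in_itv /= => /andP[s0 se] hs.
have sgt0 : 0 < s.
  rewrite lt0r s0 andbT; apply/eqP => s00; move: hs; rewrite s00 ray0.
  by move=> /eqP; rewrite -subr_eq0 opprD addNKr oppr_eq0 gt_eqF.
(* The subgradient inequality at the new point, looking back to [v j], turns the average growth into
   a lower bound on the slope. *)
have slope : 1 <= vgrad k v (v j + s *: t) (fun=> t).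
  have := vdist_ge v (v j + s *: t) ((- s) *: t).
  rewrite (vgradZ v _ (- s) (fun=> t)) scaleNr addrK.
  have := vdist_ray_ge jk t1 gt (ltW sgt0) => h1 h2.
  rewrite -(ler_pM2l sgt0) mulr1; lra.
exists s; split=> //; split.
  move=> l lk; apply/eqP; have [->|lj] := eqVneq l j.
    rewrite -subr_eq0 addrAC subrr add0r -euclid_norm_eq0 euclid_normZ t1 mulr1.
    by rewrite normr_eq0 gt_eqF.
  rewrite -subr_eq0 -euclid_norm_eq0 gt_eqF // addrAC.
  have := euclid_normD (v j - v l + s *: t) (- (s *: t)).
  rewrite addrK euclid_normN euclid_normZ t1 mulr1 gtr0_norm // => h1.
  by have := ev l lk (elimN eqP lj); lra.
exists ((vgrad k v (v j + s *: t) (fun=> t))^-1 *: t).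
by rewrite (vgradZ v _ _ (fun=> t)) mulVf // gt_eqF // (lt_le_trans ltr01).
Qed.

(** Close to [v j] the slot of [v j] sees the direction [t], while the unit vectors towards all
    other vantage points move only by a multiple of [s]. *)
Lemma vgrad_ray v j t h (s : R) : (j < k)%N -> euclid_norm t = 1 -> 0 < s ->
  (forall l, (l < k)%N -> v j + s *: t <> v l) ->
  (forall l, (l < k)%N -> l <> j -> v j <> v l) ->
  `|vgrad k v (v j + s *: t) h - (dot t (h j) + vgrad k v (v j) h)| <=
  s * \sum_(l < k) 2 / euclid_norm (v j - v l) * euclid_norm (h l).
Proof.
move=> jk t1 s0 sv vv; rewrite mulr_sumr.
rewrite /vgrad (bigD1 (Ordinal jk)) //= (bigD1 (Ordinal jk) (P := xpredT)) //=.
rewrite [leRHS](bigD1 (Ordinal jk)) //=.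
have -> : v j + s *: t - v j = s *: t by rewrite addrAC subrr add0r.
rewrite subrr unitv0 dot0l add0r.
have -> : unitv (s *: t) = t.
  by rewrite /unitv euclid_normZ t1 mulr1 gtr0_norm // scalerA mulVf ?scale1r // gt_eqF.
rewrite opprD addrACA subrr add0r euclid_norm0 invr0 mulr0 mul0r mulr0 add0r.
rewrite -sumrB; apply: le_trans (ler_norm_sum _ _ _) _.
apply: ler_sum => l lj; rewrite addrAC.
have pl0 : v j - v l != 0.
  by rewrite subr_eq0; apply/eqP/vv => // lj'; move/eqP: lj; apply; exact: val_inj.
have pls : v j - v l + s *: t != 0.
  by rewrite addrAC subr_eq0; apply/eqP/sv.
apply: le_trans (dot_unitvD _ pl0 pls) _.
by rewrite euclid_normZ t1 mulr1 gtr0_norm // -!mulrA mulrCA.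
Qed.

Lemma dot_delta (p : 'rV[R]_d) i : dot p (delta_mx ord0 i) = p ord0 i.
Proof.
rewrite /dot (bigD1 i) //= big1 => [|j ji]; first by rewrite mxE !eqxx mulr1 addr0.
by rewrite mxE (negbTE ji) andbF mulr0.
Qed.

(** This is where dimension at least two enters the lower bound. *)
Lemma orthogonal_exists (p : 'rV[R]_d) : (2 <= d)%N ->
  exists2 e : 'rV[R]_d, e != 0 & dot p e = 0.
Proof.
move=> d2; pose i0 : 'I_d := Ordinal (ltnW d2); pose i1 : 'I_d := Ordinal d2.
have [p0|pn0] := eqVneq (p ord0 i0) 0.
  exists (delta_mx ord0 i0); last by rewrite dot_delta.
  by apply/eqP => /rowP/(_ i0)/eqP; rewrite !mxE !eqxx oner_eq0.
exists (p ord0 i1 *: delta_mx ord0 i0 - p ord0 i0 *: delta_mx ord0 i1).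
  apply/eqP => /rowP/(_ i1)/eqP; rewrite !mxE !eqxx /= mulr0 add0r mulr1 oppr_eq0.
  by rewrite (negbTE pn0).
by rewrite dotBr !dotZr !dot_delta mulrC subrr.
Qed.

(** The variation is linear in the direction, so it is nonnegative along one of two opposite unit
    vectors. *)
Lemma unitv_halfspace v x (p : 'rV[R]_d) : p != 0 ->
  exists2 t, euclid_norm t = 1 /\ 0 <= vgrad k v x (fun=> t) &
    exists2 c : R, c != 0 & t = c *: p.
Proof.
move=> p0; have n0 : (euclid_norm p)^-1 != 0 by rewrite invr_eq0 euclid_norm_eq0.
have u1 := euclid_norm_unitv p0.
have [g0|g0] := leP 0 (vgrad k v x (fun=> unitv p)).
  by exists (unitv p) => //; exists (euclid_norm p)^-1.
exists ((-1) *: unitv p).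
  by rewrite (vgradZ v x (-1) (fun=> _)) euclid_normZ normrN1 mul1r u1 mulN1r oppr_ge0 ltW.
by exists (- (euclid_norm p)^-1); rewrite ?oppr_eq0 // scalerA mulN1r.
Qed.

(** Leave [v j] along a direction parallel to [h j] and along one orthogonal to it, up to the same
    level. The two gradients applied to [h] then differ by nearly [dot t (h j)], which is nonzero.
    The list [ex] contains levels already in use. *)
Lemma level_pair_nonorthogonal v j h (ex : seq R) : (2 <= d)%N -> (j < k)%N ->
  (forall l, (l < k)%N -> l <> j -> v j <> v l) -> h j != 0 ->
  exists x y, [/\ level_pair k v x y, vdist k v x \notin ex &
    vgrad k v x h != vgrad k v y h].
Proof.
move=> d2 jk vj hj.
have [e e0 he] := orthogonal_exists (h j) d2.
have [t [t1 gt] [c c0 tE]] := unitv_halfspace v (v j) hj.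
have [t' [t'1 gt'] [c' c'0 t'E]] := unitv_halfspace v (v j) e0.
have dt : dot t (h j) != 0.
  by rewrite tE dotZl -sqr_euclid_norm mulf_neq0 // sqrf_eq0 euclid_norm_eq0.
have dt' : dot t' (h j) = 0 by rewrite t'E dotZl dotC he mulr0.
set M := \sum_(l < k) 2 / euclid_norm (v j - v l) * euclid_norm (h l).
have M0 : 0 <= M.
  by apply: sumr_ge0 => l _; rewrite mulr_ge0 ?divr_ge0 ?euclid_norm_ge0.
have den : 0 < 2 * M + 1 by rewrite ltr_wpDl // mulr_ge0.
have : \forall s \near (0 : R)^'+, [/\ 0 < s,
    forall l : 'I_k, l <> j :> nat -> s < euclid_norm (v j - v l),
    vdist k v (v j) + s \notin ex & s * (2 * M + 1) < `|dot t (h j)|].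
  near=> s; split.
  - by near: s; exact: nbhs_right_gt.
  - near: s; apply: filter_forall => l; have [->|lj] := eqVneq (l : nat) j.
      by apply: filterE.
    apply: filterS (nbhs_right_lt _) => [s ? _|]; first by eassumption.
    by rewrite euclid_norm_gt0 subr_eq0; apply/eqP/vj => //; exact/eqP.
  - near: s; elim: ex => [|u ex IH]; first exact: filterE.
    have : \forall s \near (0 : R)^'+, vdist k v (v j) + s != u.
      have [uv|vu] := leP u (vdist k v (v j)).
        apply: filterS (nbhs_right_gt _) => s s0; rewrite gt_eqF //.
        by rewrite (le_lt_trans uv) // ltrDl.
      have : 0 < u - vdist k v (v j) by rewrite subr_gt0.
      by move/nbhs_right_lt; apply: filterS => s su; rewrite lt_eqF // addrC -ltrBrDr.
    by move: IH; apply: filterS2 => s h1 h2; rewrite inE negb_or h2 h1.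
  - rewrite -ltr_pdivlMr //; near: s; apply: nbhs_right_lt.
    by apply: divr_gt0 => //; rewrite normr_gt0.
move=> /filter_ex[s [s0 sv sex sM]].
have sv' l : (l < k)%N -> l <> j -> s < euclid_norm (v j - v l).
  by move=> lk; exact: (sv (Ordinal lk)).
have [u [u0 us uE ureg]] := ray_regular jk t1 gt s0 sv'.
have [u' [u'0 u's u'E u'reg]] := ray_regular jk t'1 gt' s0 sv'.
exists (v j + u *: t), (v j + u' *: t'); split.
- by split=> //; rewrite uE u'E.
- by rewrite uE.
have := vgrad_ray h jk t1 u0 ureg.1 vj; have := vgrad_ray h jk t'1 u'0 u'reg.1 vj.
rewrite -/M dt' add0r => h' hh; apply/eqP => eqg; move: sM.
rewrite ltNge => /negP; apply.
have : `|dot t (h j)| <= u * M + u' * M.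
  have -> : dot t (h j) = (vgrad k v (v j + u' *: t') h - vgrad k v (v j) h) -
      (vgrad k v (v j + u *: t) h - (dot t (h j) + vgrad k v (v j) h)).
    by rewrite eqg; ring.
  by rewrite (le_trans (ler_normB _ _)) // addrC lerD.
have : u * M <= s * M by rewrite ler_wpM2r.
have : u' * M <= s * M by rewrite ler_wpM2r.
by lra.
Unshelve. all: by end_near. Qed.

End PairsNearVantagePoint.

Section TransversalPairs.
Variables (R : realType) (d k : nat).
Implicit Types (v h a b : nat -> 'rV[R]_d).

Lemma mxvec_dot m n (A B : 'M[R]_(m, n)) :
  \sum_s mxvec A ord0 s * mxvec B ord0 s = \sum_i \sum_j A i j * B i j.
Proof.
rewrite pair_bigA (reindex _ (curry_mxvec_bij m n)) /=.
by apply: eq_bigr => -[i j] _; rewrite /= !mxvecE.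
Qed.

(** Fewer than [k * d] linear forms on a space of dimension [k * d] have a common nonzero zero. *)
Lemma vgrad_kernel r v a b : (r < k * d)%N -> exists h,
  (exists2 j, (j < k)%N & h j != 0) /\
  forall g, (g < r)%N -> vgrad k v (a g) h - vgrad k v (b g) h = 0.
Proof.
move=> rkd; pose G (g : 'I_r) : 'M[R]_(k, d) :=
  \matrix_(l, i) (unitv (a g - v l) - unitv (b g - v l)) ord0 i.
pose A := (\matrix_(g < r) mxvec (G g))^T.
have : kermx A != 0.
  by rewrite -mxrank_eq0 mxrank_ker -lt0n subn_gt0 (leq_ltn_trans (rank_leq_col _)).
move=> /rowV0Pn[u /sub_kermxP uA u0].
pose U : 'M[R]_(k, d) := vec_mx u.
pose h l : 'rV[R]_d := if insub l is Some l' then row l' U else 0.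
have hE (l : 'I_k) : h l = row l U by rewrite /h valK.
exists h; split.
  have : U != 0 by rewrite vec_mx_eq0.
  move=> /eqP/matrixP/existsNP[l /existsNP[i Uli]]; exists l => //.
  by rewrite hE; apply/eqP => /rowP/(_ i) h0; apply: Uli; move: h0; rewrite [LHS]mxE !mxE.
move=> g gr; have := congr1 (fun B : 'rV_r => B ord0 (Ordinal gr)) uA.
rewrite !mxE -{1}(vec_mxK u) -/U => <-.
rewrite /vgrad -sumrB; under [RHS]eq_bigr do rewrite !mxE.
rewrite (mxvec_dot U (G (Ordinal gr))); apply: eq_bigr => l _.
rewrite -dotBl; apply: eq_bigr => i _; rewrite hE !mxE mulrC //.
Qed.

(** Pairs are added one at a time: take [h] killed by all earlier forms and a new pair whose form
    does not kill it. Adding a multiple of [h] solves the new equation without disturbing the old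
    ones. *)
Lemma transversal_pairs_exist v r : (2 <= d)%N ->
  (forall l l', (l < k)%N -> (l' < k)%N -> v l = v l' -> l = l') ->
  (r <= k * d)%N -> exists a b, transversal_pairs k r v a b.
Proof.
move=> d2 v_inj; elim: r => [|r IH] rkd.
  by exists (fun=> 0), (fun=> 0); split=> // y; exists (fun=> 0).
have [a [b [pairP lev_inj surj]]] := IH (ltnW rkd).
have [h [[j jk hj] hker]] := vgrad_kernel v a b rkd.
have vj l : (l < k)%N -> l <> j -> v j <> v l.
  by move=> lk lj /v_inj jl; apply: lj; rewrite jl.
have [x [y [xy xlev hxy]]] :=
  level_pair_nonorthogonal (mkseq (fun g => vdist k v (a g)) r) d2 jk vj hj.
pose upd (f : nat -> 'rV[R]_d) z g := if g == r then z else f g.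
have updr f z : upd f z r = z by rewrite /upd eqxx.
have updl f z g : (g < r)%N -> upd f z g = f g by move=> gr; rewrite /upd ltn_eqF.
have ltrS g : (g < r.+1)%N -> g = r \/ (g < r)%N.
  by rewrite ltnS leq_eqVlt => /predU1P.
have xlev' g : (g < r)%N -> vdist k v x <> vdist k v (a g).
  move=> gr e; move/negP: xlev; apply; rewrite e; apply/mapP; exists g => //.
  by rewrite mem_iota.
exists (upd a x), (upd b y); split.
- by move=> g /ltrS[->|gr]; rewrite ?updr ?updl //; exact: pairP.
- move=> g g' /ltrS[->|gr] /ltrS[->|gr'] //; rewrite ?updr ?updl //.
  + by move/xlev' => /(_ gr').
  + by move/esym/xlev' => /(_ gr).
  + exact: lev_inj.
- move=> z; have [h1 h1P] := surj z.
  pose c := (z r - (vgrad k v x h1 - vgrad k v y h1)) / (vgrad k v x h - vgrad k v y h).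
  exists (fun l => h1 l + c *: h l) => g /ltrS[->|gr]; rewrite ?updr ?updl //;
    rewrite !vgradD !vgradZ.
    have den : vgrad k v x h - vgrad k v y h != 0 by rewrite subr_eq0.
    by rewrite opprD addrACA -mulrBr /c divfK // addrC subrK.
  by rewrite opprD addrACA -mulrBr hker // mulr0 addr0 h1P.
Qed.

End TransversalPairs.

(** * Transversal pairs on the line *)

Section LinePairs.
Variable R : realType.
Implicit Types (v h a b : nat -> R) (x y M : R).

Definition ldist k v x : R := \sum_(l < k) `|x - v l|.
Definition lgrad k v x h : R := \sum_(l < k) Num.sg (x - v l) * h l.

Definition line_regular k v x :=
  (forall l, (l < k)%N -> x <> v l) /\ lgrad k v x (fun=> 1) != 0.

Definition line_pairs k r v a b :=
  [/\ forall g, (g < r)%N ->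
        [/\ line_regular k v (a g), line_regular k v (b g) &
            ldist k v (a g) = ldist k v (b g)],
      forall g g', (g < r)%N -> (g' < r)%N ->
        ldist k v (a g) = ldist k v (a g') -> g = g' &
      forall y : nat -> R, exists h, forall g, (g < r)%N ->
        lgrad k v (a g) h - lgrad k v (b g) h = y g].

Lemma right_side k v x : (forall l, (l < k)%N -> v l < x) ->
  [/\ forall l, (l < k)%N -> x <> v l,
      ldist k v x = k%:R * x - \sum_(l < k) v l &
      forall h, lgrad k v x h = \sum_(l < k) h l].
Proof.
move=> vx; split=> [l /vx/gt_eqF/negbT/eqP //||h].
- rewrite /ldist (eq_bigr (fun l : 'I_k => x - v l)) => [|l _].
    by rewrite sumrB sumr_const card_ord mulr_natl.
  by rewrite gtr0_norm // subr_gt0 vx.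
- by apply: eq_bigr => l _; rewrite gtr0_sg ?mul1r // subr_gt0 vx.
Qed.

Lemma left_side k v x : (forall l, (l < k)%N -> x < v l) ->
  [/\ forall l, (l < k)%N -> x <> v l,
      ldist k v x = \sum_(l < k) v l - k%:R * x &
      forall h, lgrad k v x h = - \sum_(l < k) h l].
Proof.
move=> vx; split=> [l /vx/lt_eqF/negbT/eqP //||h].
- rewrite /ldist (eq_bigr (fun l : 'I_k => v l - x)) => [|l _].
    by rewrite sumrB sumr_const card_ord mulr_natl.
  by rewrite ltr0_norm ?opprB // subr_lt0 vx.
- by rewrite -sumrN; apply: eq_bigr => l _; rewrite ltr0_sg ?mulN1r // subr_lt0 vx.
Qed.

Lemma line_pairs1 k : (0 < k)%N -> line_pairs k 1 (fun=> 0) (fun=> -1) (fun=> 1).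
Proof.
move=> k0.
have [r1 r2 r3] := @right_side k (fun=> 0) 1 (fun _ _ => ltr01).
have [l1 l2 l3] := @left_side k (fun=> 0) (-1) (fun _ _ => ltrN10 R).
have k0' : k%:R != 0 :> R by rewrite pnatr_eq0 -lt0n.
split.
- move=> _ _; split; last by rewrite r2 l2 mulrN opprK mulr1 big1 // subr0 add0r.
    by split=> //; rewrite l3 sumr_const card_ord oppr_eq0.
  by split=> //; rewrite r3 sumr_const card_ord.
- by move=> [|g] [|g'].
(* The two gradients are opposite, so moving a single vantage point by half the target suffices. *)
- move=> y; exists (fun l => if l == 0%N then - (y 0%N / 2) else 0) => -[|//] _.
  rewrite r3 l3; have -> : \sum_(l < k) (if l == 0%N :> nat then - (y 0%N / 2) else 0) = - (y 0%N / 2).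
    rewrite (bigD1 (Ordinal k0)) //= big1 ?addr0 // => l l0.
    by case: ifP => // /eqP l0'; case/eqP: l0; exact: val_inj.
  by lra.
Qed.

Definition extend2 (f : nat -> R) k x y l :=
  if l == k then x else if l == k.+1 then y else f l.

Lemma extend2_lt f k x y l : (l < k)%N -> extend2 f k x y l = f l.
Proof. by move=> lk; rewrite /extend2 !ltn_eqF // ltnS ltnW. Qed.

Lemma extend2_k f k x y : extend2 f k x y k = x.
Proof. by rewrite /extend2 eqxx. Qed.

Lemma extend2_k1 f k x y : extend2 f k x y k.+1 = y.
Proof. by rewrite /extend2 eqxx gtn_eqF. Qed.

Lemma sum_extend2 f k x y (F : R -> R) :
  \sum_(l < k.+2) F (extend2 f k x y l) = \sum_(l < k) F (f l) + F x + F y.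
Proof.
rewrite !big_ord_recr /= extend2_k extend2_k1; congr (_ + _ + _).
by apply: eq_bigr => l _; rewrite extend2_lt.
Qed.

Lemma lgrad_extend2 v k x y z h (h1 h2 : R) :
  lgrad k.+2 (extend2 v k x y) z (extend2 h k h1 h2) =
  lgrad k v z h + Num.sg (z - x) * h1 + Num.sg (z - y) * h2.
Proof.
rewrite /lgrad !big_ord_recr /= !extend2_k !extend2_k1; congr (_ + _ + _).
by apply: eq_bigr => l _; rewrite !extend2_lt.
Qed.

Lemma lgrad1_extend2 v k x y z :
  lgrad k.+2 (extend2 v k x y) z (fun=> 1) =
  lgrad k v z (fun=> 1) + Num.sg (z - x) + Num.sg (z - y).
Proof.
rewrite /lgrad (eq_bigr (fun l : 'I__ => Num.sg (z - extend2 v k x y l))).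
  rewrite (sum_extend2 v k x y (fun u => Num.sg (z - u))).
  by congr (_ + _ + _); apply: eq_bigr => l _; rewrite mulr1.
by move=> l _; rewrite mulr1.
Qed.

Lemma bounded_upto (f : nat -> R) n : exists2 M : R, 0 <= M & forall i, (i < n)%N -> `|f i| <= M.
Proof.
exists (\sum_(i < n) `|f i|) => [|i lt_in]; first exact: sumr_ge0.
by rewrite (bigD1 (Ordinal lt_in)) //= lerDl sumr_ge0.
Qed.

(* The two new vantage points [Rt] and [- L] lie on both sides of the old
   configuration, where they only shift [ldist] by a constant and do not affect
   [lgrad]; of the two new pairs, one encloses [Rt] only and one encloses both. *)
Lemma line_pairs_step k r v a b : (0 < k)%N -> line_pairs k r v a b ->
  exists v' a' b', line_pairs k.+2 r.+2 v' a' b'.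
Proof.
move=> k0 [pairP lev_inj surj].
have [Mv Mv0 vM] := bounded_upto v k.
have [Ma Ma0 aM] := bounded_upto a r.
have [Mb Mb0 bM] := bounded_upto b r.
pose M := Mv + Ma + Mb; have M0 : 0 <= M by rewrite !addr_ge0.
have inM z N : `|z| <= N -> N <= M -> - M <= z <= M.
  by move=> zN NM; rewrite -ler_norml (le_trans zN).
have vM' l : (l < k)%N -> - M <= v l <= M.
  by move=> /vM h; apply: inM h _; rewrite /M; lra.
have aM' g : (g < r)%N -> - M <= a g <= M.
  by move=> /aM h; apply: inM h _; rewrite /M; lra.
have bM' g : (g < r)%N -> - M <= b g <= M.
  by move=> /bM h; apply: inM h _; rewrite /M; lra.
set K : R := k%:R; have K0 : 0 < K by rewrite ltr0n.
have sumK : \sum_(l < k) (1 : R) = K by rewrite sumr_const card_ord.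
pose S := \sum_(l < k) v l.
have SM : - (K * M) <= S <= K * M.
  rewrite -ler_norml (le_trans (ler_norm_sum _ _ _)) //.
  rewrite /K mulr_natl -[X in _ *+ X]card_ord -sumr_const; apply: ler_sum => l _.
  by rewrite ler_norml vM'.
(* Solves equality of levels at [- A] and [Rt + 1]. Since [dA] does not involve [Rt], the latter can
   be chosen large afterwards. *)
pose dA := (K + 2 - 2 * S) / K.
have dAE : K * dA = K + 2 - 2 * S by rewrite /dA mulrC divfK // gt_eqF.
(* The summand [|dA|] keeps both [Rt] and [A] beyond [3 * M + 1] whatever the sign of [dA];
   [L = A + 1] puts [- L] just outside [- A]. *)
pose Rt := 3 * M + 1 + `|dA|; pose A := Rt + dA; pose L := A + 1.
have dA1 : - `|dA| <= dA by rewrite lerNl -normrN ler_norm.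
have dA2 : 0 <= `|dA| by [].
have RtM : 3 * M + 1 <= Rt by rewrite /Rt; lra.
have AM : 3 * M + 1 <= A by rewrite /A /Rt; lra.
(* Solves equality of levels at [- A2] and [B], which lie outside both new vantage points. *)
pose dB := 2 * (S + Rt - L) / (K + 2).
have dBE : (K + 2) * dB = 2 * (S + Rt - L).
  by rewrite /dB mulrC divfK // gt_eqF // ltr_wpDl // ltW.
have dB1 : dB <= `|dB| by exact: ler_norm.
have dB2 : 0 <= `|dB| by [].
pose B := Rt + L + 2 + `|dB|; pose A2 := B - dB.
have BR : Rt + L + 2 <= B by rewrite /B; lra.
have A2L : Rt + L + 2 <= A2 by rewrite /A2 /B; lra.
have KA : K * A = K * Rt + (K + 2 - 2 * S) by rewrite /A mulrDr dAE.
have KA2 : (K + 2) * A2 = (K + 2) * B - 2 * (S + Rt - L) by rewrite /A2 mulrBr dBE.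
clearbody dA dB Rt A M.
pose v' := extend2 v k Rt (- L).
pose a' := extend2 a r (- A) (- A2).
pose b' := extend2 b r (Rt + 1) B.
have ltrS g : (g < r.+2)%N -> [\/ (g < r)%N, g = r | g = r.+1].
  rewrite !ltnS leq_eqVlt => /predU1P[->|]; first by constructor 3.
  by rewrite ltnS leq_eqVlt => /predU1P[->|]; [constructor 2|constructor 1].
have ldistE z : ldist k.+2 v' z = ldist k v z + `|z - Rt| + `|z + L|.
  by rewrite /ldist (sum_extend2 v k Rt (- L) (fun u => `|z - u|)) opprK.
have v'_neq z : (forall l, (l < k)%N -> z <> v l) -> z <> Rt -> z <> - L ->
    forall l, (l < k.+2)%N -> z <> v' l.
  move=> h1 h2 h3 l; rewrite !ltnS leq_eqVlt => /predU1P[->|]; first by rewrite /v' extend2_k1.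
  rewrite ltnS leq_eqVlt => /predU1P[->|lk]; first by rewrite /v' extend2_k.
  by rewrite /v' extend2_lt //; exact: h1.
have inner z : - M <= z <= M -> [/\ Num.sg (z - Rt) = -1, Num.sg (z - - L) = 1 &
    ldist k.+2 v' z = ldist k v z + (Rt + L)].
  move=> /andP[h1 h2]; split.
  - by rewrite ltr0_sg //; lra.
  - by rewrite gtr0_sg //; rewrite /L; lra.
  - by rewrite ldistE ltr0_norm ?gtr0_norm; rewrite /L; lra.
have innerR z : - M <= z <= M -> line_regular k v z -> line_regular k.+2 v' z.
  move=> zM [z1 z2]; have [s1 s2 _] := inner z zM; split.
    by move: zM => /andP[h1 h2]; apply: v'_neq => // hz; move: h1 h2; rewrite hz /L; lra.
  by rewrite lgrad1_extend2 s1 s2 subrK.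
have [ra1 ra2 ra3] : [/\ forall l, (l < k)%N -> - A <> v l,
      ldist k v (- A) = S - K * - A & forall h, lgrad k v (- A) h = - \sum_(l < k) h l].
  by apply: left_side => l /vM'/andP[h1 h2]; lra.
have [rb1 rb2 rb3] : [/\ forall l, (l < k)%N -> Rt + 1 <> v l,
      ldist k v (Rt + 1) = K * (Rt + 1) - S & forall h, lgrad k v (Rt + 1) h = \sum_(l < k) h l].
  by apply: right_side => l /vM'/andP[h1 h2]; lra.
have [qa1 qa2 qa3] : [/\ forall l, (l < k)%N -> - A2 <> v l,
      ldist k v (- A2) = S - K * - A2 & forall h, lgrad k v (- A2) h = - \sum_(l < k) h l].
  by apply: left_side => l /vM'/andP[h1 h2]; rewrite /L in A2L; lra.
have [qb1 qb2 qb3] : [/\ forall l, (l < k)%N -> B <> v l,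
      ldist k v B = K * B - S & forall h, lgrad k v B h = \sum_(l < k) h l].
  by apply: right_side => l /vM'/andP[h1 h2]; rewrite /L in BR; lra.
have sa : Num.sg (- A - Rt) = -1 /\ Num.sg (- A - - L) = 1.
  by split; [rewrite ltr0_sg //; lra|rewrite gtr0_sg //; rewrite /L; lra].
have sb : Num.sg (Rt + 1 - Rt) = 1 /\ Num.sg (Rt + 1 - - L) = 1.
  by split; rewrite gtr0_sg //; rewrite /L; lra.
have sqa : Num.sg (- A2 - Rt) = -1 /\ Num.sg (- A2 - - L) = -1.
  by split; rewrite ltr0_sg //; rewrite /L in A2L *; lra.
have sqb : Num.sg (B - Rt) = 1 /\ Num.sg (B - - L) = 1.
  by split; rewrite gtr0_sg //; rewrite /L in BR *; lra.
have da : ldist k.+2 v' (- A) = K * A + S + L + Rt.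
  by rewrite ldistE ra2 ltr0_norm ?gtr0_norm; rewrite /L; lra.
have db : ldist k.+2 v' (Rt + 1) = (K + 2) * (Rt + 1) - S + L - Rt.
  by rewrite ldistE rb2 !gtr0_norm; rewrite /L; lra.
have dqa : ldist k.+2 v' (- A2) = (K + 2) * A2 + S + Rt - L.
  by rewrite ldistE qa2 !ltr0_norm; rewrite /L in A2L *; lra.
have dqb : ldist k.+2 v' B = (K + 2) * B - S - Rt + L.
  by rewrite ldistE qb2 !gtr0_norm; rewrite /L in BR *; lra.
have eq1 : ldist k.+2 v' (- A) = ldist k.+2 v' (Rt + 1) by rewrite da db; lra.
have eq2 : ldist k.+2 v' (- A2) = ldist k.+2 v' B by rewrite dqa dqb; lra.
(* Old levels before the shift are at most [2 * K * M], while [K * A + S] exceeds this because [A]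
   is at least [3 * M + 1]. *)
have lt1 g : (g < r)%N -> ldist k.+2 v' (a g) < ldist k.+2 v' (- A).
  move=> gr; have [_ _ ->] := inner _ (aM' g gr); rewrite da.
  have : ldist k v (a g) <= 2 * K * M.
    rewrite -mulrA mulrCA /K mulr_natl -[X in _ *+ X]card_ord -sumr_const.
    apply: ler_sum => l _; have /andP[? ?] := aM' g gr; have /andP[? ?] := vM' l (ltn_ord l).
    by rewrite ler_norml; apply/andP; split; lra.
  have : K * (3 * M + 1) <= K * A by rewrite ler_pM2l.
  by move: SM => /andP[]; lra.
have lt2 : ldist k.+2 v' (- A) < ldist k.+2 v' (- A2).
  rewrite eq1 eq2 db dqb; have : (K + 2) * (Rt + 1) < (K + 2) * B.
    by rewrite ltr_pM2l; rewrite /L in BR *; lra.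
  by lra.
exists v', a', b'; split.
- move=> g /ltrS[gr|->|->]; rewrite /a' /b' ?extend2_k ?extend2_k1 ?extend2_lt //.
  + have [ag bg dg] := pairP g gr; split; [exact/innerR/ag/aM'|exact/innerR/bg/bM'|].
    by have [_ _ ->] := inner _ (aM' g gr); have [_ _ ->] := inner _ (bM' g gr); rewrite dg.
  + split=> //; split.
    * by apply: v'_neq => //; rewrite /L; lra.
    * by rewrite lgrad1_extend2 sa.1 sa.2 ra3 sumK subrK oppr_eq0 gt_eqF.
    * by apply: v'_neq => //; rewrite /L; lra.
    * by rewrite lgrad1_extend2 sb.1 sb.2 rb3 sumK gt_eqF //; lra.
  + split=> //; split.
    * by apply: v'_neq => //; rewrite /L in A2L *; lra.
    * by rewrite lgrad1_extend2 sqa.1 sqa.2 qa3 sumK lt_eqF //; lra.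
    * by apply: v'_neq => //; rewrite /L in BR *; lra.
    * by rewrite lgrad1_extend2 sqb.1 sqb.2 qb3 sumK gt_eqF //; lra.
- move=> g g' /ltrS[gr|->|->] /ltrS[gr'|->|->] //;
    rewrite /a' ?extend2_k ?extend2_k1 ?extend2_lt // => e.
  + have [_ _ e1] := inner _ (aM' g gr); have [_ _ e2] := inner _ (aM' g' gr').
    by apply: lev_inj => //; move: e; rewrite e1 e2 => /addIr.
  + by have := lt1 g gr; rewrite e ltxx.
  + by have := lt_trans (lt1 g gr) lt2; rewrite e ltxx.
  + by have := lt1 g' gr'; rewrite e ltxx.
  + by have := lt2; rewrite e ltxx.
  + by have := lt_trans (lt1 g' gr') lt2; rewrite e ltxx.
  + by have := lt2; rewrite e ltxx.
(* The system is triangular: old pairs ignore both new slots, the first new pair fixes [h1], and the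
   second then fixes [h2]. *)
- move=> y; have [h hP] := surj y; pose T := \sum_(l < k) h l.
  pose h1 := - (y r / 2) - T; pose h2 := - (y r.+1 / 2) - T - h1.
  exists (extend2 h k h1 h2) => g /ltrS[gr|->|->];
    rewrite !lgrad_extend2 /a' /b' ?extend2_k ?extend2_k1 ?extend2_lt //.
  + have [-> -> _] := inner _ (aM' g gr); have [-> -> _] := inner _ (bM' g gr).
    by have := hP g gr; lra.
  + by rewrite sa.1 sa.2 sb.1 sb.2 ra3 rb3 -/T /h1; lra.
  + by rewrite sqa.1 sqa.2 sqb.1 sqb.2 qa3 qb3 -/T /h2; lra.
Qed.

(** Start from one or two vantage points, according to parity, with one pair; each step adds two
    vantage points and two pairs. *)
Lemma line_pairs_exist k : (0 < k)%N ->
  exists v a b, line_pairs k (2 * uphalf k - 1) v a b.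
Proof.
suff h k0 j : (0 < k0)%N -> exists v a b, line_pairs (k0 + j.*2) j.*2.+1 v a b.
  case: k => // k _; have [v [a [b P]]] := h (1 + odd k)%N k./2 isT.
  exists v, a, b; have <- : (1 + odd k + k./2.*2 = k.+1)%N by rewrite -addnA odd_double_half.
  suff -> : (2 * uphalf (1 + odd k + k./2.*2) - 1 = (k./2).*2.+1)%N by [].
  by have := odd_double_half k; case: (odd k) => /=; lia.
move=> k00; elim: j => [|j [v [a [b P]]]].
  by rewrite addn0; exists (fun=> 0), (fun=> -1), (fun=> 1); exact: line_pairs1.
rewrite doubleS !addnS; apply: (line_pairs_step _ P).
by rewrite addn_gt0 k00.
Qed.

(** In dimension one [unitv] is the sign, also at 0, so [vgrad] becomes [lgrad]. *)
Lemma line_pairs_transversal k r v a b : line_pairs k r v a b ->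
  transversal_pairs k r (fun l => const_mx (v l) : 'rV[R]_1)
    (fun g => const_mx (a g)) (fun g => const_mx (b g)).
Proof.
move=> [pairP lev_inj surj].
pose cm (x : R) : 'rV[R]_1 := const_mx x.
have cmB x y : cm x - cm y = cm (x - y) by apply/rowP => i; rewrite !mxE.
have ncm x : euclid_norm (cm x) = `|x|.
  by rewrite /euclid_norm big_ord1 mxE sqrtr_sqr.
have dcm x y : dot (unitv (cm x)) (cm y) = Num.sg x * y.
  rewrite /dot big_ord1 !mxE ncm; congr (_ * _); have [->|x0] := eqVneq x 0.
    by rewrite mulr0 sgr0.
  by rewrite {2}(numEsg x) mulrCA mulVf ?mulr1 // normr_eq0.
have ED x : vdist k (fun l => cm (v l)) (cm x) = ldist k v x.
  by apply: eq_bigr => l _; rewrite cmB ncm.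
have EG x h : vgrad k (fun l => cm (v l)) (cm x) (fun l => cm (h l)) = lgrad k v x h.
  by apply: eq_bigr => l _; rewrite cmB dcm.
have reg x : line_regular k v x -> regular_point k (fun l => cm (v l)) (cm x).
  move=> [xv s0]; split.
    by move=> l /xv h /rowP/(_ ord0); rewrite !mxE => /h.
  pose c := (lgrad k v x (fun=> 1))^-1; exists (cm c); rewrite (EG x (fun=> c)).
  apply: etrans (mulfV s0); rewrite -/c /lgrad mulr_suml.
  by apply: eq_bigr => l _; rewrite mulr1.
split.
- by move=> g gr; have [ag bg dg] := pairP g gr; split; [exact: reg|exact: reg|rewrite !ED].
- by move=> g g' gr gr'; rewrite !ED; exact: lev_inj.
- by move=> y; have [h hP] := surj y; exists (fun l => cm (h l)) => g gr; rewrite !EG hP.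
Qed.

End LinePairs.

(** * Asymptotics *)

Section Asymptotics.
Variables (R : realType) (d k r : nat).

Lemma psi_max_theta (m : nat) : (0 < d)%N -> (0 < r)%N -> m = (2 * r)%N ->
  (exists K, forall C : {fset 'rV[R]_d}, (0 < #|` C|)%N ->
    (psi k C <= K * #|` C| ^ m)%N) ->
  (exists v a b : nat -> 'rV[R]_d, transversal_pairs k r v a b) ->
  (fun n : nat => (psi_max R d k n)%:R : R^o)
    =Theta_\oo (fun n : nat => n%:R ^+ m : R^o).
Proof.
move=> d0 r0 mE [K Kub] [v [a [b vab]]]; rewrite eqThetaE qualifE; apply/asboolP.
(* With [p] the integer part of [n / 2r], which is at least 1, [n] is at most [2r * (p + 1)] and
   hence at most [4r * p]. *)
pose c : R := (4 * r)%:R ^+ m.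
have c0 : 0 < c by rewrite exprn_gt0 // ltr0n muln_gt0.
(* The successor makes the upper constant positive even when [K] is 0. *)
exists (c^-1, K.+1%:R); first by rewrite /= invr_gt0 c0 ltr0n.
near=> n; have rn : (2 * r <= n)%N by near: n; exact: nbhs_infty_ge.
have n0 : (0 < n)%N by rewrite (leq_trans _ rn) // muln_gt0.
have [[C Cn psiC] psi_le] := psi_maxP R k n d0.
rewrite /= -!natrX !normr_nat -natrM ler_nat; split.
  pose p := (n %/ (2 * r))%N.
  have r20 : (0 < 2 * r)%N by rewrite muln_gt0.
  have p0 : (0 < p)%N by rewrite divn_gt0.
  have [C' C'n] := psi_lower vab r0 p0 (leq_trans (eq_leq (mulnC _ _)) (leq_divM n (2 * r))).
  move=> /leq_trans/(_ (psi_le _ C'n)); rewrite -expnM -mE => le_p.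
  rewrite ler_pdivrMl // /c -natrX -natrM ler_nat.
  apply: leq_trans (leq_mul (leqnn _) le_p); rewrite -expnMn leq_exp2r; last first.
    by rewrite mE muln_gt0.
  apply: (@leq_trans (p.+1 * (2 * r))%N); first exact: ltnW (ltn_ceil n r20).
  by move: p0; nia.
rewrite -psiC (leq_trans (Kub C _)) ?Cn //.
by rewrite leq_mul2r leqnSn orbT.
Unshelve. all: by end_near. Qed.

End Asymptotics.

Theorem theorem1p1 (R : realType) (d k : nat) (hd : (1 <= d)%N)
    (hk : (1 <= k)%N) :
  ((2 <= d)%N ->
     (fun n : nat => (psi_max R d k n)%:R : R^o)
       =Theta_\oo (fun n : nat => n%:R ^+ (2 * d * k) : R^o)) /\
  (d = 1%N ->
     (fun n : nat => (psi_max R 1 k n)%:R : R^o)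
       =Theta_\oo (fun n : nat => n%:R ^+ (4 * uphalf k - 2) : R^o)).
Proof.
split=> [d2|d1].
  apply: (@psi_max_theta R d k (k * d)) => //.
  - by rewrite muln_gt0 hk hd.
  - by rewrite -mulnA [(d * k)%N]mulnC.
  - exact: psi_upper.
  - exists (fun l => const_mx l%:R); apply: transversal_pairs_exist => //.
    move=> l l' _ _ /rowP/(_ (Ordinal hd)); rewrite !mxE => /eqP.
    by rewrite eqr_nat => /eqP.
have k20 : (0 < uphalf k)%N by rewrite uphalf_gt0.
apply: (@psi_max_theta R 1 k (2 * uphalf k - 1)) => //; first by lia.
- by lia.
(* For odd [k] the exponent equals [2k] and the general bound is enough; the saving from the medians
   is needed for even [k]. *)
- have [ok|ek] := boolP (odd k).
    have [K KP] := psi_upper R k (isT : (0 < 1)%N); exists K => C C0.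
    suff -> : (4 * uphalf k - 2 = 2 * 1 * k)%N by exact: KP.
    by have := odd_double_half k; rewrite uphalf_half ok -muln2; lia.
  have [j kE] : exists j, k = j.+1.*2.
    exists k./2.-1; have := odd_double_half k; rewrite (negbTE ek) -!muln2.
    by move: hk; lia.
  by rewrite kE uphalf_double; exact: psi_upper_even.
- have [v [a [b vab]]] := line_pairs_exist R hk.
  by exists (fun l => const_mx (v l)), (fun g => const_mx (a g)), (fun g => const_mx (b g));
    exact: line_pairs_transversal.
Qed.
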